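(* Let $\mathrm{NF}=(\mathrm{NF}_1,\mathrm{NF}_2)$ be the normal form on $\mathbb{K}[[\underline s,\underline x]]$ defined in the context and $\pi_H:\mathbb{K}[[\underline s,\underline x]]\to H=\mathbb{K}[[\underline s,\underline x]]/\langle\underline F\rangle\mathbb{K}[[\underline s,\underline x]]$ the canonical projection. Then $\mathrm{NF}_1$ is a surjective $\mathbb{K}[[\underline s]]$-linear map $$\mathrm{NF}_1:\mathbb{K}[[\underline s,\underline x]]\longrightarrow\langle\underline m\rangle\mathbb{K}[[\underline s]]$$ over $H$, i.e. $\pi_H\circ\mathrm{NF}_1=\pi_H$, where also the restriction $\pi_H:\langle\underline m\rangle\mathbb{K}[[\underline s]]\to H$ is surjective, and $\mathrm{NF}_1^2=\mathrm{NF}_1$. In particular, if $H$ is a free $\mathbb{K}[[\underline s]]$-module, then $\mathrm{NF}_1$ induces a $\mathbb{K}[[\underline s]]$-linear section $H\to\mathbb{K}[[\underline s,\underline x]]$ of $\pi_H$ (again denoted $\mathrm{NF}_1$, so that its composition with $\pi_H:\mathbb{K}[[\underline s,\underline x]]\to H$ is the map $\mathrm{NF}_1$ above) with image $\mathrm{NF}_1(H)=\langle\underline m\rangle\mathbb{K}[[\underline s]]$; that is, $\mathrm{NF}_1$ is the $\underline m$-basis representation.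
   Context: **Family.** $\mathbb{K}$ is a computable field, $\underline x=x_1,\dots,x_n$, $\underline\partial=\partial_1,\dots,\partial_n$ with $\partial_i=\partial_{x_i}$, $\underline s=s_1,\dots,s_m$. $\mathbb{K}[[\underline s,\underline x]]\langle\underline\partial\rangle$ is the ring of differential operators that are polynomial in $\underline\partial$ with coefficients in $\mathbb{K}[[\underline s,\underline x]]$ ($[\partial_i,x_j]=\delta_{i,j}$, the $s_j$ central); it acts on $\mathbb{K}[[\underline s,\underline x]]$. Let $\underline F=F_1,\dots,F_r\in\mathbb{K}[[\underline s,\underline x]]\langle\underline\partial\rangle$ be a row vector, $\langle\underline F\rangle\mathbb{K}[[\underline s,\underline x]]=\{\sum_iF_i(p_i)\mid p_i\in\mathbb{K}[[\underline s,\underline x]]\}$ (a $\mathbb{K}[[\underline s]]$-submodule), $H=\mathbb{K}[[\underline s,\underline x]]/\langle\underline F\rangle\mathbb{K}[[\underline s,\underline x]]$. Assume that $\underline f=f_1,\dots,f_r=\underline F(\underline s=\underline 0)$ lies in $\mathbb{K}[[\underline x]]$ (no $\underline\partial$) and that $\langle\underline x\rangle^k\mathbb{K}[[\underline x]]\subset\langle\underline f\rangle\mathbb{K}[[\underline x]]$ for some $k\ge0$. Write $\underline F=\underline f-\underline sD$, where $D\in\mathbb{K}[[\underline s,\underline x]]\langle\underline\partial\rangle^{m\times r}$ has rows $\underline d^1,\dots,\underline d^m$, so $\underline sD=\sum_js_j\underline d^j$. **Orderings and degrees.** $<_{\underline x}$ is a local degree ordering on the monomials of $\mathbb{K}[[\underline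 x]]$ with respect to a weighted degree $\deg_{\underline x}:\mathbb{N}^n\to\mathbb{Q}$: $\deg_{\underline x}$ is a semigroup homomorphism with $\deg_{\underline x}(x_i)<0$, and $<_{\underline x}$ is a (total) semigroup ordering with $\deg_{\underline x}(\underline x^{\underline\alpha})<\deg_{\underline x}(\underline x^{\underline\beta})\Rightarrow\underline x^{\underline\alpha}<_{\underline x}\underline x^{\underline\beta}$. Likewise $<_{\underline s}$ is a local degree ordering with weighted degree $\deg_{\underline s}$ on the monomials of $\mathbb{K}[[\underline s]]$. $<=(<_{\underline s},<_{\underline x})$ is the block ordering on monomials of $\mathbb{K}[[\underline s,\underline x]]$ (compare the $\underline s$-parts first by $<_{\underline s}$, then the $\underline x$-parts by $<_{\underline x}$). $\mathrm{lead}(p)$ is the leading term of $p\neq0$, i.e. the term of $p$ (with coefficient) whose monomial is maximal with respect to $<$ (resp. $<_{\underline x}$ on $\mathbb{K}[[\underline x]]$). For $0\ne p=\sum_{\underline\alpha}p_{\underline\alpha}\underline s^{\underline\alpha}$ with $p_{\underline\alpha}\in\mathbb{K}[[\underline x]]$, $\mathrm{lead}_{\underline s}(p)=p_{\underline\alpha}\underline s^{\underline\alpha}$ for the $<_{\underline s}$-maximal $\underline s^{\underline\alpha}$ with $p_{\underline\alpha}\ne0$. On monomials, $\deg(\underline s^{\underline\alpha}\underline x^{\underline\beta})=\deg_{\underline s}(\underline s^{\underline\alpha})+\deg_{\underline x}(\underline x^{\underline\beta})$, extended by $\deg(\partial_i)=-\deg_{\underline x}(x_i)$; the degree of a series or operator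 is the maximum of the degrees of its terms. $\min\deg$ and $\max\deg$ of a vector or matrix denote the minimal and maximal degree of its components. **Standard basis.** $\underline g=g_1,\dots,g_l$ is a standard basis of $\langle\underline f\rangle\mathbb{K}[[\underline x]]$: $0\ne g_i\in\langle\underline f\rangle\mathbb{K}[[\underline x]]$ and the leading terms of $\langle\underline f\rangle\mathbb{K}[[\underline x]]$ generate the ideal $\langle\mathrm{lead}(g_1),\dots,\mathrm{lead}(g_l)\rangle$. $\underline m=(m_i)_{i=1,\dots,\mu}$ are the (finitely many) monomials $\underline x^{\underline\beta}\notin\langle\mathrm{lead}(\underline g)\rangle\mathbb{K}[[\underline x]]$, ordered increasingly; $\langle\underline m\rangle\mathbb{K}[[\underline s]]$ is the $\mathbb{K}[[\underline s]]$-submodule they generate. $U=(\overline u_1,\dots,\overline u_l)\in\mathbb{K}[[\underline x]]^{r\times l}$ is a matrix with $\underline g=\underline fU$, and $\underline G=G_1,\dots,G_l=\underline FU=\underline g-\underline sDU$. **Degree conditions.** The weights $\deg(s_j)$ satisfy $\deg(s_j)\le\min\deg(\underline m)+\min\deg(\underline x)-\max\deg(\underline d^j)$ for all $j$, and for integers $K\le0$, $N_K=-K\min\deg(\underline s)-\min\deg(\underline x)+\max\deg(D)$, a strictly increasing sequence of rational numbers (in particular $D\neq0$ and $\underline m$ is non-empty). **Algorithm.** For $p\in\mathbb{K}[[\underline s,\underline x]]$ and an integer $K\le0$, $\mathrm{NF}(p,K)=(r,\overline a,q)\in\mathbb{K}[[\underline s,\underline x]]\times\mathbb{K}[[\underline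 s,\underline x]]^l\times\mathbb{K}[[\underline s,\underline x]]$ is computed recursively: 1. If $p\in\langle\underline s\rangle^{-K}$, set $q_0:=p$; else if $\deg\mathrm{lead}(p)<N_K$ or $\mathrm{lead}_{\underline s}(p)\in\langle\underline s\rangle^{-K}$, set $q_0:=\mathrm{lead}_{\underline s}(p)$; else set $q_0:=0$. Set $r_0:=p-q_0$. 2. If $r_0=0$, return $(0,\overline 0,q_0)$. 3. If $\mathrm{lead}(r_0)\in\langle\mathrm{lead}(\underline g)\rangle$, let $j$ be minimal with $\mathrm{lead}(r_0)\in\langle\mathrm{lead}(g_j)\rangle$, $c:=\mathrm{lead}(r_0)/\mathrm{lead}(g_j)$, $(r',\overline a',q'):=\mathrm{NF}(r_0-cg_j+\underline sD(c\,\overline u_j),K)$, and return $(r',\overline a'+c\,\overline e_j,q_0+q')$, where $\overline e_j$ is the $j$-th unit vector. 4. Otherwise let $(r',\overline a',q'):=\mathrm{NF}(r_0-\mathrm{lead}(r_0),K)$ and return $(\mathrm{lead}(r_0)+r',\overline a',q_0+q')$. **Normal form on $\mathbb{K}[[\underline s,\underline x]]$.** Fix a strictly decreasing sequence $(K_i)_{i\ge0}$ of integers $\le0$. For $p\in\mathbb{K}[[\underline s,\underline x]]$ put $p_0=p$, $(r_i,\overline a_i,p_{i+1})=\mathrm{NF}(p_i,K_i)$ for $i\ge0$, and $$\mathrm{NF}(p)=(\mathrm{NF}_1(p),\mathrm{NF}_2(p))=\Bigl(\sum_{i\ge0}r_i,\sum_{i\ge0}\overline a_i\Bigr),$$ the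 sums converging in the $\langle\underline s,\underline x\rangle$-adic topology. *)

(* Defs.v *)
From HB Require Import structures.
From mathcomp Require Import all_boot all_order all_algebra.
From mathcomp Require Import boolp classical_sets finmap.
From mathcomp Require Import mpoly.

Set Implicit Arguments.
Unset Strict Implicit.
Unset Printing Implicit Defensive.

Import Order.TTheory GRing.Theory Num.Theory.

Local Open Scope classical_set_scope.
Local Open Scope ring_scope.
Local Open Scope quotient_scope.

Record fps (n : nat) (R : nzRingType) := Fps { fcoef :> 'X_{1..n} -> R }.

Notation "{ 'fps' R [ n ] }" := (fps n R)
  (at level 0, R, n at level 2, format "{ 'fps'  R [ n ] }") : type_scope.

Lemma fpsP n (R : nzRingType) (p q : {fps R[n]}) : p =1 q -> p = q.
Proof. by case: p q => [p] [q] /= /funext ->. Qed.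

HB.instance Definition _ n (R : nzRingType) := gen_eqMixin {fps R[n]}.
HB.instance Definition _ n (R : nzRingType) := gen_choiceMixin {fps R[n]}.

Section FpsRing.
Context (n : nat) (R : comNzRingType).
Implicit Types p q : {fps R[n]}.

Definition fps_zero : {fps R[n]} := Fps (fun=> 0).
Definition fps_opp p : {fps R[n]} := Fps (fun b => - p b).
Definition fps_add p q : {fps R[n]} := Fps (fun b => p b + q b).

Fact fps_addA : associative fps_add.
Proof. by move=> p q t; apply: fpsP => b /=; rewrite addrA. Qed.
Fact fps_addC : commutative fps_add.
Proof. by move=> p q; apply: fpsP => b /=; rewrite addrC. Qed.
Fact fps_add0 : left_id fps_zero fps_add.
Proof. by move=> p; apply: fpsP => b /=; rewrite add0r. Qed.
Fact fps_addN : left_inverse fps_zero fps_opp fps_add.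
Proof. by move=> p; apply: fpsP => b /=; rewrite addNr. Qed.

HB.instance Definition _ :=
  GRing.isZmodule.Build {fps R[n]} fps_addA fps_addC fps_add0 fps_addN.

Definition fpsX (b : 'X_{1..n}) : {fps R[n]} := Fps (fun c => (c == b)%:R).

Definition fps_mul p q : {fps R[n]} :=
  Fps (fun b => \sum_(k : 'X_{1..n < (mdeg b).+1, (mdeg b).+1}
                      | b == (k.1 + k.2)%MM) p k.1 * q k.2).

(* The ring axioms are inherited from polynomials: the coefficients of degree
   less than d of a product only depend on the truncations at degree d. *)
Definition fps_trunc d p : {mpoly R[n]} :=
  \sum_(b : 'X_{1..n < d}) p b *: 'X_[b].

Lemma mcoeff_trunc d p b : (mdeg b < d)%N -> (fps_trunc d p)@_b = p b.
Proof. exact: mcoeff_mpoly. Qed.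

Lemma mcoeffM_eq (P P' Q Q' : {mpoly R[n]}) d b : (mdeg b < d)%N ->
  (forall c, (mdeg c < d)%N -> P@_c = P'@_c) ->
  (forall c, (mdeg c < d)%N -> Q@_c = Q'@_c) ->
  (P * Q)@_b = (P' * Q')@_b.
Proof.
move=> bd hP hQ; rewrite !mcoeffM; apply: eq_bigr => -[k1 k2] /= _.
by rewrite hP ?hQ //; apply: leq_trans bd; apply: (valP (_ : 'X_{1..n < _})).
Qed.

Lemma fps_mulE d p q b : (mdeg b < d)%N ->
  fps_mul p q b = (fps_trunc d p * fps_trunc d q)@_b.
Proof.
move=> bd; rewrite mcoeffM /=; apply: eq_bigr => -[k1 k2] /= _.
by rewrite !mcoeff_trunc //; apply: leq_trans bd;
  apply: (valP (_ : 'X_{1..n < _})).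
Qed.

Lemma trunc_mul d p q b : (mdeg b < d)%N ->
  (fps_trunc d (fps_mul p q))@_b = (fps_trunc d p * fps_trunc d q)@_b.
Proof. by move=> bd; rewrite mcoeff_trunc // (fps_mulE _ _ bd). Qed.

Fact fps_mulA : associative fps_mul.
Proof.
move=> p q t; apply: fpsP => b; pose d := (mdeg b).+1.
have bd : (mdeg b < d)%N by [].
rewrite !(fps_mulE _ _ bd).
rewrite (@mcoeffM_eq _ (fps_trunc d p) _
  (fps_trunc d q * fps_trunc d t) _ _ bd) //; last exact: trunc_mul.
rewrite [RHS](@mcoeffM_eq _ (fps_trunc d p * fps_trunc d q) _
  (fps_trunc d t) _ _ bd) //; last exact: trunc_mul.
by rewrite mulrA.
Qed.

Fact fps_mulC : commutative fps_mul.
Proof.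
move=> p q; apply: fpsP => b; have bd := ltnSn (mdeg b).
by rewrite !(fps_mulE _ _ bd) mulrC.
Qed.

Lemma trunc_one d b : (mdeg b < d)%N ->
  (fps_trunc d (fpsX 0%MM))@_b = (1 : {mpoly R[n]})@_b.
Proof. by move=> bd; rewrite mcoeff_trunc // mcoeff1. Qed.

Fact fps_mul1 : left_id (fpsX 0%MM) fps_mul.
Proof.
move=> p; apply: fpsP => b; have bd := ltnSn (mdeg b).
rewrite (fps_mulE _ _ bd) (@mcoeffM_eq _ 1 _ (fps_trunc (mdeg b).+1 p) _ _ bd) //.
  by rewrite mul1r mcoeff_trunc.
exact: trunc_one.
Qed.

Fact fps_mulDl : left_distributive fps_mul fps_add.
Proof.
move=> p q t; apply: fpsP => b /=; rewrite -big_split /=.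
by apply: eq_bigr => k _; rewrite mulrDl.
Qed.

Fact fps_one_neq0 : fpsX 0%MM != 0.
Proof.
apply/eqP => /(congr1 (fun p : {fps R[n]} => p 0%MM)) /=.
by rewrite eqxx; apply/eqP; rewrite oner_neq0.
Qed.

HB.instance Definition _ := GRing.Zmodule_isComNzRing.Build {fps R[n]}
  fps_mulA fps_mulC fps_mul1 fps_mulDl fps_one_neq0.

Definition fps_scale (a : R) p : {fps R[n]} := Fps (fun b => a * p b).

Fact fps_scaleA a b p : fps_scale a (fps_scale b p) = fps_scale (a * b) p.
Proof. by apply: fpsP => c /=; rewrite mulrA. Qed.
Fact fps_scale1 : left_id 1 fps_scale.
Proof. by move=> p; apply: fpsP => c /=; rewrite mul1r. Qed.
Fact fps_scaleDr : right_distributive fps_scale +%R.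
Proof. by move=> a p q; apply: fpsP => c /=; rewrite mulrDr. Qed.
Fact fps_scaleDl p : {morph fps_scale^~ p : a b / a + b}.
Proof. by move=> a b; apply: fpsP => c /=; rewrite mulrDl. Qed.

HB.instance Definition _ := GRing.Zmodule_isLmodule.Build R {fps R[n]}
  fps_scaleA fps_scale1 fps_scaleDr fps_scaleDl.

Fact fps_scaleAl (a : R) p q : a *: (p * q) = a *: p * q.
Proof.
apply: fpsP => c /=; rewrite mulr_sumr.
by apply: eq_bigr => k _; rewrite mulrA.
Qed.

HB.instance Definition _ := GRing.Lmodule_isLalgebra.Build R {fps R[n]}
  fps_scaleAl.

Definition fps_deriv (i : 'I_n) p : {fps R[n]} :=
  Fps (fun b => p (b + U_(i))%MM *+ (b i).+1).

Definition fps_derivm (c : 'X_{1..n}) p : {fps R[n]} :=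
  foldr (fun i q => iter (c i) (fps_deriv i) q) p (enum 'I_n).

End FpsRing.

Arguments fpsX {n R} b.

Definition ideal_span (R : comNzRingType) (A : set R) : set R :=
  [set p | exists s : seq (R * R),
    (forall t, t \in s -> A t.2) /\ p = \sum_(t <- s) t.1 * t.2].

Definition ideal_exp (R : comNzRingType) (I : set R) (k : nat) : set R :=
  ideal_span [set p | exists a : 'I_k -> R,
    (forall i, I (a i)) /\ p = \prod_i a i].

Definition lmod_basis (R : nzRingType) (M : lmodType R) (I : choiceType)
    (e : I -> M) : Prop :=
  forall h : M, exists! c : {fsfun I -> R with 0},
    h = \sum_(i <- finsupp c) c i *: e i.

Definition free_lmodule (R : nzRingType) (M : lmodType R) : Prop :=
  exists (I : choiceType) (e : I -> M), lmod_basis e.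

(* Locality is the negativity of the weights. *)
Definition local_degree_ordering (n : nat) (deg : 'X_{1..n} -> rat)
    (lt : rel 'X_{1..n}) : Prop :=
  [/\ forall a b, deg (a + b)%MM = deg a + deg b,
      forall i, deg U_(i)%MM < 0
    & forall a b, deg a < deg b -> lt a b] /\
  [/\ irreflexive lt,
      transitive lt,
      forall a b, a != b -> lt a b || lt b a
    & forall a b c, lt a b -> lt (a + c)%MM (b + c)%MM].

Definition block_lt (m n : nat) (lts : rel 'X_{1..m}) (ltx : rel 'X_{1..n}) :
    rel ('X_{1..m} * 'X_{1..n}) :=
  fun a b => lts a.1 b.1 || (a.1 == b.1) && ltx a.2 b.2.

(* Attained extrema; 0 by convention when there is none. *)
Definition setmax (A : set rat) : rat := xget 0 [set d | A d /\ ubound A d].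
Definition setmin (A : set rat) : rat := xget 0 [set d | A d /\ lbound A d].

(* The leading term, with its coefficient, in K[[x]]; the value at 0 is 0. *)
Definition xlead (K : fieldType) (n : nat) (ltx : rel 'X_{1..n})
    (p : {fps K[n]}) : {fps K[n]} :=
  xget 0 [set t | exists b, [/\ p b != 0,
    forall b', p b' != 0 -> b' = b \/ ltx b' b & t = p b *: fpsX b]].

Definition standard_basis (K : fieldType) (n r l : nat) (ltx : rel 'X_{1..n})
    (f : 'rV[{fps K[n]}]_r) (g : 'rV[{fps K[n]}]_l) : Prop :=
  let I := ideal_span (range (f 0)) in
  (forall i, g 0 i != 0 /\ I (g 0 i)) /\
  ideal_span [set xlead ltx p | p in [set p | I p /\ p != 0]]
    = ideal_span (range (fun i => xlead ltx (g 0 i))).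

(* The monomials outside <lead(g)>, listed increasingly. *)
Definition standard_monomials (K : fieldType) (n l mu : nat)
    (ltx : rel 'X_{1..n}) (g : 'rV[{fps K[n]}]_l)
    (mon : 'I_mu -> 'X_{1..n}) : Prop :=
  (forall b, (exists i, mon i = b) <->
     ~ ideal_span (range (fun i => xlead ltx (g 0 i))) (fpsX b)) /\
  (forall i j : 'I_mu, (i < j)%N -> ltx (mon i) (mon j)).

(* K[[s,x]] is K[[s]][[x]]: the coefficient of s^a x^b in p is p b a, and the
   K[[s]]-module structure is the coefficientwise one. *)
Notation Ksx K m n := {fps {fps K[m]}[n]}.

Section Ksx.
Context (K : fieldType) (m n : nat).
Implicit Types p q : Ksx K m n.

Definition svar (j : 'I_m) : Ksx K m n := fpsX U_(j)%MM *: 1.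
Definition xvar (i : 'I_n) : Ksx K m n := fpsX U_(i)%MM.

Definition sideal : set (Ksx K m n) := ideal_span (range svar).
Definition sxideal : set (Ksx K m n) := ideal_span (range svar `|` range xvar).

Definition xemb (p : {fps K[n]}) : Ksx K m n := Fps (fun b => p b *: 1).

(* The coefficient in K[[x]] of s^a. *)
Definition scoef p (a : 'X_{1..m}) : {fps K[n]} := Fps (fun b => p b a).

Definition adic_sum (u : nat -> Ksx K m n) (v : Ksx K m n) : Prop :=
  forall N, exists M, forall k, (M <= k)%N ->
    ideal_exp sxideal N (v - \sum_(i < k) u i).

Definition mspan (mu : nat) (mon : 'I_mu -> 'X_{1..n}) : set (Ksx K m n) :=
  [set p | exists c : 'I_mu -> {fps K[m]}, p = \sum_i c i *: fpsX (mon i)].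

Definition lead (lts : rel 'X_{1..m}) (ltx : rel 'X_{1..n}) p : Ksx K m n :=
  xget 0 [set t | exists a b, [/\ p b a != 0,
    forall a' b', p b' a' != 0 ->
      (a', b') = (a, b) \/ block_lt lts ltx (a', b') (a, b)
    & t = (p b a *: fpsX a) *: fpsX b]].

Definition slead (lts : rel 'X_{1..m}) p : Ksx K m n :=
  xget 0 [set t | exists a, [/\ scoef p a != 0,
    forall a', scoef p a' != 0 -> a' = a \/ lts a' a
    & t = fpsX a *: xemb (scoef p a)]].

Definition termdegs (degs : 'X_{1..m} -> rat) (degx : 'X_{1..n} -> rat) p :
    set rat :=
  [set d | exists a b, p b a != 0 /\ d = degs a + degx b].

End Ksx.

Arguments svar {K m n} j.
Arguments xvar {K m n} i.
Arguments xemb {K} m {n} p.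
Arguments mspan K m {n mu} mon.

(* An operator of K[[s,x]]<d> is stored in normal form, as the finite sum of
   the P@_c d^c with coefficients P@_c on the left.  Only the left module
   structure of {mpoly _} is kept: its commutative product is not the
   composition of operators. *)
Definition diffop (K : fieldType) (m n : nat) : Type := {mpoly (Ksx K m n)[n]}.

HB.instance Definition _ K m n :=
  GRing.Lmodule.copy (diffop K m n) {mpoly (Ksx K m n)[n]}.

Section DiffOp.
Context (K : fieldType) (m n r : nat).
Implicit Types P : diffop K m n.

Definition dcoef P (c : 'X_{1..n}) : Ksx K m n := mcoeff c P.

Definition dact P (p : Ksx K m n) : Ksx K m n :=
  \sum_(c <- msupp P) dcoef P c * fps_derivm c p.

Definition dop0 (p : Ksx K m n) : diffop K m n := p%:MP.

Definition dtermdegs (degs : 'X_{1..m} -> rat) (degx : 'X_{1..n} -> rat) P :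
    set rat :=
  [set d | exists a b c, dcoef P c b a != 0 /\ d = degs a + degx b - degx c].

Definition sDact (D : 'M[diffop K m n]_(m, r)) (v : 'cV[Ksx K m n]_r) :
    Ksx K m n :=
  \sum_j svar j * \sum_i dact (D j i) (v i 0).

(* The row vector F = f - s D. *)
Definition Fop (f : 'rV[{fps K[n]}]_r) (D : 'M[diffop K m n]_(m, r)) :
    'rV[diffop K m n]_r :=
  \row_i (dop0 (xemb m (f 0 i)) - \sum_j svar j *: D j i).

Lemma fps_deriv_linear i (c : {fps K[m]}) (p q : Ksx K m n) :
  fps_deriv i (c *: p + q) = c *: fps_deriv i p + fps_deriv i q.
Proof. by apply: fpsP => b /=; rewrite mulrnDl mulrnAr. Qed.

Lemma fps_derivm_linear b (c : {fps K[m]}) (p q : Ksx K m n) :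
  fps_derivm b (c *: p + q) = c *: fps_derivm b p + fps_derivm b q.
Proof.
rewrite /fps_derivm; elim: (enum _) => [|i s IHs] //=; rewrite {}IHs.
by elim: (b i) => [|k IHk] //=; rewrite IHk fps_deriv_linear.
Qed.

Lemma dact_linear P (c : {fps K[m]}) (p q : Ksx K m n) :
  dact P (c *: p + q) = c *: dact P p + dact P q.
Proof.
rewrite /dact scaler_sumr -big_split /=; apply: eq_bigr => b _.
by rewrite fps_derivm_linear mulrDr mulrC -scalerAl mulrC.
Qed.

Definition imF (F : 'rV[diffop K m n]_r) : {pred Ksx K m n} :=
  fun p => `[< exists q : 'I_r -> Ksx K m n, p = \sum_i dact (F 0 i) (q i) >].

Fact imF_submod F : submod_closed (imF F).
Proof.
have d0 P : dact P 0 = 0.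
  by have := dact_linear P (-1) 0 0; rewrite scaler0 addr0 scaleN1r addNr.
split=> [|c _ _ /asboolP[p ->] /asboolP[q ->]]; apply/asboolP.
  by exists (fun=> 0); rewrite big1.
exists (fun i => c *: p i + q i); rewrite scaler_sumr -big_split /=.
by apply: eq_bigr => i _; rewrite dact_linear.
Qed.

HB.instance Definition _ F :=
  GRing.isSubmodClosed.Build {fps K[m]} (Ksx K m n) (imF F) (imF_submod F).

Definition Hmod (F : 'rV[diffop K m n]_r) : Type := {ideal_quot imF F}.

HB.instance Definition _ F := GRing.Zmodule.on (Hmod F).

Definition piH F (p : Ksx K m n) : Hmod F := \pi_{ideal_quot imF F} p.

Definition Hscale F (c : {fps K[m]}) (h : Hmod F) : Hmod F :=
  piH F (c *: repr (h : {ideal_quot imF F})).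

Lemma piH_eq F p q : p - q \in imF F -> piH F p = piH F q.
Proof. by rewrite Quotient.idealrBE => /eqP. Qed.

Lemma piH_repr F (h : Hmod F) : piH F (repr (h : {ideal_quot imF F})) = h.
Proof. exact: reprK. Qed.

Lemma piHZ F c p : piH F (c *: p) = Hscale c (piH F p).
Proof.
apply: piH_eq; rewrite -scalerBr; apply: rpredZ.
by rewrite Quotient.idealrBE reprK.
Qed.

Lemma piHD F p q : piH F (p + q) = piH F p + piH F q.
Proof. exact: (raddfD (\pi_{ideal_quot imF F})). Qed.

Fact HscaleA F c d (h : Hmod F) : Hscale c (Hscale d h) = Hscale (c * d) h.
Proof. by rewrite -(piH_repr h) -!piHZ scalerA. Qed.
Fact Hscale1 F : left_id 1 (@Hscale F).
Proof. by move=> h; rewrite -(piH_repr h) -piHZ scale1r. Qed.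
Fact HscaleDr F : right_distributive (@Hscale F) +%R.
Proof.
move=> c h h'; rewrite -(piH_repr h) -(piH_repr h') -piHD -!piHZ.
by rewrite scalerDr piHD.
Qed.
Fact HscaleDl F (h : Hmod F) : {morph (@Hscale F)^~ h : c d / c + d}.
Proof. by move=> c d; rewrite -(piH_repr h) -!piHZ scalerDl piHD. Qed.

HB.instance Definition _ F := GRing.Zmodule_isLmodule.Build {fps K[m]} (Hmod F)
  (@HscaleA F) (@Hscale1 F) (@HscaleDr F) (@HscaleDl F).

End DiffOp.

Section NormalForm.
Context (K : fieldType) (m n r l : nat).
Context (degs : 'X_{1..m} -> rat) (degx : 'X_{1..n} -> rat).
Context (lts : rel 'X_{1..m}) (ltx : rel 'X_{1..n}).
Context (D : 'M[diffop K m n]_(m, r)).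
Context (g : 'rV[{fps K[n]}]_l) (U : 'M[{fps K[n]}]_(r, l)).
Implicit Types (p q t : Ksx K m n) (a : 'rV[Ksx K m n]_l) (k : int).

Definition minx : rat := setmin (range (fun i : 'I_n => degx U_(i)%MM)).
Definition mins : rat := setmin (range (fun j : 'I_m => degs U_(j)%MM)).
Definition minmon (mu : nat) (mon : 'I_mu -> 'X_{1..n}) : rat :=
  setmin (range (degx \o mon)).
Definition maxrow (j : 'I_m) : rat :=
  setmax (\bigcup_i dtermdegs degs degx (D j i)).
Definition maxD : rat :=
  setmax (\bigcup_j \bigcup_i dtermdegs degs degx (D j i)).

(* A zero row d^j has degree -oo and imposes no condition. *)
Definition degree_condition (mu : nat) (mon : 'I_mu -> 'X_{1..n}) : Prop :=
  forall j, row j D != 0 -> degs U_(j)%MM <= minmon mon + minx - maxrow j.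

Definition NK (k : int) : rat := - k%:~R * mins - minx + maxD.

Definition lead_g (j : 'I_l) : Ksx K m n := xemb m (xlead ltx (g 0 j)).

(* For integers k <= 0, absz k is - k. *)
Definition NF_q0 (k : int) p : Ksx K m n :=
  if `[< ideal_exp (@sideal K m n) (absz k) p >] then p
  else if `[< setmax (termdegs degs degx (lead lts ltx p)) < NK k \/
              ideal_exp (@sideal K m n) (absz k) (slead lts p) >]
  then slead lts p else 0.

(* NFK k p t a q: the recursive computation of NF(p, k) terminates and
   returns (t, a, q). *)
Inductive NFK (k : int) :
    Ksx K m n -> Ksx K m n -> 'rV[Ksx K m n]_l -> Ksx K m n -> Prop :=
| NFK_stop p :
    p - NF_q0 k p = 0 -> NFK k p 0 0 (NF_q0 k p)
| NFK_reduce p (j : 'I_l) (c : Ksx K m n) t a q (r0 : Ksx K m n := p - NF_q0 k p) :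
    r0 != 0 ->
    ideal_span (range lead_g) (lead lts ltx r0) ->
    (forall j' : 'I_l, (j' < j)%N ->
       ~ ideal_span [set lead_g j'] (lead lts ltx r0)) ->
    lead lts ltx r0 = c * lead_g j ->
    NFK k (r0 - c * xemb m (g 0 j)
           + sDact D (c *: map_mx (xemb m) (col j U))) t a q ->
    NFK k p t (a + c *: delta_mx 0 j) (NF_q0 k p + q)
| NFK_keep p t a q (r0 : Ksx K m n := p - NF_q0 k p) :
    r0 != 0 ->
    ~ ideal_span (range lead_g) (lead lts ltx r0) ->
    NFK k (r0 - lead lts ltx r0) t a q ->
    NFK k p (lead lts ltx r0 + t) a (NF_q0 k p + q).

(* is_NF k p t a: NF(p) = (t, a) for the sequence k of integers. *)
Definition is_NF (k : nat -> int) p t a : Prop :=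
  exists (ps ts : nat -> Ksx K m n) (As : nat -> 'rV[Ksx K m n]_l),
    [/\ ps 0%N = p,
        forall i, NFK (k i) (ps i) (ts i) (As i) (ps i.+1),
        adic_sum ts t
      & forall j, adic_sum (fun i => As i 0 j) (a 0 j)].

End NormalForm.

(* Main.v *)
(* Every p has exactly one expression p = r + sum_j g_j a_j - sD(U a) in which r
   lies in <m>K[[s]] and x^b occurs in a_j only if g_j is the first element of g
   whose leading monomial divides x^b lead(g_j).  Indeed p is obtained from the
   pair (r, a) by a K[[s]]-linear map which is unitriangular for the
   well-founded block ordering, because g_j - lead(g_j) lies below lead(g_j) and
   sD lowers the s-part.  The steps of the algorithm produce expressions of this
   kind, so NF(p) is this unique (r, a) as soon as the iteration converges;
   linearity, idempotency and pi_H NF_1 = pi_H then follow from uniqueness and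
   from F U = g - sDU.  Convergence holds since the errors p_i tend to 0 and the
   inverse of the triangular map is adically continuous.

   If H is free, the presentation K[[s]]^mu -> H by the monomials m splits, and
   at s = 0 its kernel vanishes because g is a standard basis; hence it is an
   isomorphism. *)

Require Import Defs.
From HB Require Import structures.
From mathcomp Require Import all_boot all_order all_algebra.
From mathcomp Require Import boolp classical_sets finmap.
From mathcomp Require Import mpoly ssrcomplements.
From mathcomp Require Import zify lra.

Set Implicit Arguments.
Unset Strict Implicit.
Unset Printing Implicit Defensive.

Import Order.TTheory GRing.Theory Num.Theory.

Local Open Scope classical_set_scope.
Local Open Scope ring_scope.

(** * Power series and ideals *)

(** The pair (r, a) is encoded as one series z, which turns the K[[s]]-linear map of the overview
    into an endomorphism [recompose] of K[[s,x]] that can be compared with the identity coefficient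
    by coefficient. Descending chains of a local ordering may be infinite, so coefficients are
    determined from above: in each block only finitely many exponents exceed a given one, hence the
    block ordering is well founded upwards, although infinitely many pairs may lie above a given
    pair. Continuity of the inverse is therefore no formal consequence of triangularity; it needs
    that [recompose] lowers the adic order by at most a constant, which comes from the bounded order
    of the operators in D and from the finitely many leading monomials. Termination of a single
    NF(p, K) is a separate matter, needed for NF(p) to exist at all: there the leading exponents go
    down, and the threshold N_K and the power <s>^{-K} provide the floor. The monotonicity of N_K
    enters only afterwards, to make the errors p_i small. *)

Section Fps.
Context (n : nat) (R : comNzRingType).
Implicit Types (p q : {fps R[n]}) (b c : 'X_{1..n}).

Lemma fpsDE p q b : (p + q) b = p b + q b. Proof. by []. Qed.
Lemma fpsNE p b : (- p) b = - p b. Proof. by []. Qed.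
Lemma fpsBE p q b : (p - q) b = p b - q b. Proof. by []. Qed.
Lemma fpsZE (u : R) p b : (u *: p) b = u * p b. Proof. by []. Qed.
Lemma fps0E b : (0 : {fps R[n]}) b = 0. Proof. by []. Qed.
Lemma fpsXE c b : (fpsX c : {fps R[n]}) b = (b == c)%:R. Proof. by []. Qed.

Lemma fps1E b : (1 : {fps R[n]}) b = (b == 0%MM)%:R. Proof. by []. Qed.

Lemma fpsMnE p j b : (p *+ j) b = p b *+ j.
Proof. by elim: j => // j IHj; rewrite !mulrS fpsDE IHj. Qed.

Lemma fps_sumE I (s : seq I) (P : pred I) (G : I -> {fps R[n]}) b :
  (\sum_(i <- s | P i) G i) b = \sum_(i <- s | P i) G i b.
Proof. exact: (big_morph (fun p : {fps R[n]} => p b)). Qed.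

Lemma fpsME p q b : (p * q) b =
  \sum_(k : 'X_{1..n < (mdeg b).+1, (mdeg b).+1} | b == (k.1 + k.2)%MM)
     p k.1 * q k.2.
Proof. by []. Qed.

Lemma fps_mul_eq0 p q b :
  (forall k1 k2, b = (k1 + k2)%MM -> p k1 * q k2 = 0) -> (p * q) b = 0.
Proof. by move=> h; rewrite fpsME big1 // => -[k1 k2] /= /eqP; apply: h. Qed.

Lemma fpsXM c q b :
  (fpsX c * q) b = if (c <= b)%MM then q (b - c)%MM else 0.
Proof.
case: ifP => [cb|/negP cb]; last first.
  apply: fps_mul_eq0 => k1 k2 bk; rewrite fpsXE.
  by case: eqP => [k1c|]; rewrite ?mul0r //; case: cb; rewrite bk k1c lem_addr.
have cd : (mdeg c < (mdeg b).+1)%N.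
  by rewrite ltnS -(submK cb) mdegD leq_addl.
have bcd : (mdeg (b - c) < (mdeg b).+1)%N by rewrite ltnS mdegB.
rewrite fpsME (bigD1 (BMultinom cd, BMultinom bcd)) /=; last first.
  by rewrite addmC submK.
rewrite eqxx mul1r big1 ?addr0 // => -[[k1 h1] [k2 h2]] /= /andP[/eqP bk ne].
case: eqP => [k1c|]; rewrite ?mul0r //; case/eqP: ne.
have k2E : k2 = (b - c)%MM by rewrite bk k1c addmC addmK.
by congr pair; apply: val_inj.
Qed.

Lemma subm_eq b c d : (c <= d)%MM && ((d - c)%MM == b) = (d == (c + b)%MM).
Proof.
apply/andP/eqP => [[cd /eqP <-]|->]; first by rewrite addmC submK.
by rewrite lem_addr addmC addmK eqxx.
Qed.

Lemma fpsXD b c : fpsX (b + c)%MM = fpsX b * fpsX c :> {fps R[n]}.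
Proof.
apply: fpsP => d; rewrite fpsXM !fpsXE -subm_eq.
by case: (b <= d)%MM.
Qed.

End Fps.

(** * Ideals spanned by a set, and their powers *)

Section IdealSpan.
Context (R : comNzRingType).
Implicit Types (A : set R) (x y : R).

Lemma ideal_span_gen A x : A x -> ideal_span A x.
Proof.
move=> Ax; exists [:: (1, x)]; split=> [t|]; last by rewrite big_seq1 mul1r.
by rewrite inE => /eqP ->.
Qed.

Lemma ideal_span0 A : ideal_span A 0.
Proof. by exists [::]; rewrite big_nil. Qed.

Lemma ideal_spanD A x y :
  ideal_span A x -> ideal_span A y -> ideal_span A (x + y).
Proof.
move=> [s [sA ->]] [t [tA ->]]; exists (s ++ t); rewrite big_cat; split=> // u.
by rewrite mem_cat => /orP[/sA|/tA].
Qed.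

Lemma ideal_spanM A x y : ideal_span A y -> ideal_span A (x * y).
Proof.
move=> [s [sA ->]]; exists [seq (x * t.1, t.2) | t <- s]; split.
  by move=> _ /mapP[t ts ->]; exact: (sA t).
by rewrite big_map mulr_sumr; apply: eq_bigr => t _; rewrite mulrA.
Qed.

Lemma ideal_span_sum A (I : Type) (s : seq I) (G : I -> R) :
  (forall i, ideal_span A (G i)) -> ideal_span A (\sum_(i <- s) G i).
Proof.
move=> h; elim/big_ind: _ => [|x y|i _].
- exact: ideal_span0.
- exact: ideal_spanD.
- exact: h.
Qed.

Lemma ideal_span_ind A (I : set R) x : A `<=` I -> I 0 ->
  (forall y z, I y -> I z -> I (y + z)) -> (forall y z, I z -> I (y * z)) ->
  ideal_span A x -> I x.
Proof.
move=> AI I0 ID IM [s [sA ->]]; rewrite big_seq.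
elim/big_ind: _ => [//|y z|t ts]; first exact: ID.
by apply/IM/AI/sA.
Qed.

Lemma ideal_exp0 A x : ideal_exp A 0 x.
Proof.
rewrite -[x]mulr1; apply/ideal_spanM/ideal_span_gen.
by exists (fun i => 0); split=> [[]|]; rewrite ?big_ord0.
Qed.

Lemma ideal_expS A N x y : A x -> ideal_exp A N y -> ideal_exp A N.+1 (x * y).
Proof.
move=> Ax [s [sA ->]]; rewrite mulr_sumr big_seq.
elim/big_ind: _ => [|u v|t ts]; [exact: ideal_span0|exact: ideal_spanD|].
rewrite mulrCA; apply: ideal_spanM; apply: ideal_span_gen.
have [a [aA ->]] := sA _ ts.
exists (fun i => oapp a x (unlift ord0 i)); split=> [i|].
  by case: unliftP => [j _|_] /=.
rewrite big_ord_recl unlift_none /=; congr (_ * _).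
by apply: eq_bigr => i _; rewrite liftK.
Qed.

End IdealSpan.

(** Turns membership in a monomial ideal into divisibility of exponents; every statement about
    <lead(g)> passes through it. *)
Lemma monomial_span_coef n (R : comNzRingType) (A : set {fps R[n]}) p b :
  ideal_span A p ->
  (forall a, A a -> exists u c, a = u *: fpsX c /\ ~~ (c <= b)%MM) -> p b = 0.
Proof.
move=> [s [sA ->]] h; rewrite fps_sumE big_seq big1 // => t /sA /h[u [c [-> cb]]].
by rewrite mulrC -scalerAl fpsZE fpsXM (negPf cb) mulr0.
Qed.
(** * Local degree orderings *)

Section LocalOrdering.
Context (n : nat) (deg : 'X_{1..n} -> rat) (lt : rel 'X_{1..n}).
Hypothesis lt_ord : local_degree_ordering deg lt.
Implicit Types (a b c : 'X_{1..n}).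

Lemma degD a b : deg (a + b)%MM = deg a + deg b.
Proof. by case: lt_ord => -[]. Qed.
Lemma degU_lt0 i : deg U_(i)%MM < 0.
Proof. by case: lt_ord => -[]. Qed.
Lemma deg_lt a b : deg a < deg b -> lt a b.
Proof. by case: lt_ord => -[_ _ +] _; apply. Qed.
Lemma ltmm a : lt a a = false.
Proof. by case: lt_ord => _ [+ _ _ _]; apply. Qed.
Lemma ltm_trans : transitive lt.
Proof. by case: lt_ord => _ []. Qed.
Lemma ltm_total a b : a != b -> lt a b || lt b a.
Proof. by case: lt_ord => _ [_ _ + _]; apply. Qed.
Lemma ltmD2r c a b : lt a b -> lt (a + c)%MM (b + c)%MM.
Proof. by case: lt_ord => _ [_ _ _ +]; apply. Qed.

Lemma ltm_deg a b : lt a b -> deg a <= deg b.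
Proof.
move=> ab; rewrite leNgt; apply/negP => /deg_lt ba.
by have := ltm_trans ab ba; rewrite ltmm.
Qed.

Lemma deg0 : deg 0%MM = 0.
Proof. by apply: (addrI (deg 0%MM)); rewrite -degD addm0 addr0. Qed.

(** Removing one variable from b lowers the left side by 1 and the right side by M times a positive
    weight, so M only has to dominate the inverses of all weights. *)
Lemma mdeg_le_deg : exists M : nat, forall b, (mdeg b)%:R <= M%:R * - deg b.
Proof.
pose B i := Num.bound (- deg U_(i)%MM)^-1.
exists (\sum_i B i)%N => b; have [N] := ubnP (mdeg b).
elim: N b => // N IHN b bN; have [->|b0] := eqVneq b 0%MM.
  by rewrite mdeg0 deg0 oppr0 mulr0.
have [i bi] : exists i, (0 < b i)%N.
  apply: contrapT => h; case/eqP: b0; apply/mnmP => i; rewrite mnm0E.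
  by case: (posnP (b i)) => // bi; case: h; exists i.
have ib : (U_(i) <= b)%MM.
  by apply/mnm_lepP => j; rewrite mnm1E; case: eqP => // <-.
rewrite -(submK ib) mdegD mdeg1 degD opprD mulrDr natrD lerD //.
  apply: IHN; move: bN; rewrite -{1}(submK ib) mdegD mdeg1; lia.
have di : 0 < - deg U_(i)%MM by rewrite oppr_gt0 degU_lt0.
rewrite -[leLHS](mulVf (lt0r_neq0 di)) ler_wpM2r ?(ltW di) //.
have di' : 0 <= (- deg U_(i)%MM)^-1 by rewrite invr_ge0 ltW.
apply: le_trans (ltW (archi_boundP di')) _.
by rewrite // ler_nat (bigD1 i) //= leq_addr.
Qed.

(** The finiteness behind all well-founded inductions: only finitely many exponents have degree at
    least d. *)
Lemma mdeg_bounded (d : rat) : exists N, forall b, d <= deg b -> (mdeg b < N)%N.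
Proof.
have [M hM] := mdeg_le_deg.
exists (Num.bound (M%:R * `|d|)) => b db; rewrite -(ltr_nat rat).
apply: le_lt_trans (hM b) _; apply: le_lt_trans (archi_boundP _); last first.
  by rewrite mulr_ge0 ?ler0n.
rewrite ler_wpM2l ?ler0n //; have := ler_norm (- d); rewrite normrN; lra.
Qed.

Lemma deg_bounded N : exists d : rat, forall b, (mdeg b < N)%N -> d <= deg b.
Proof.
exists (- \sum_(b : 'X_{1..n < N}) `|deg b|) => b bN.
rewrite lerNl (bigD1 (BMultinom bN)) //=.
have := ler_norm (- deg b); rewrite normrN => h; apply: le_trans h _.
by rewrite lerDl sumr_ge0.
Qed.

(** Going up never lowers the degree, so everything above a lies in a finite set, and by
    transitivity the number of its members above b drops at each step. *)
Lemma wf_ltm_up : well_founded (fun a b => lt b a).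
Proof.
move=> a; have [N hN] := mdeg_bounded (deg a).
pose card b := #|[pred c : 'X_{1..n < N} | lt b c]|.
suff : forall k b, (card b < k)%N -> deg a <= deg b -> Acc (fun a b => lt b a) b.
  by move=> /(_ (card a).+1 a (ltnSn _) (lexx _)).
elim=> [b|k IHk b bk ab]; first by rewrite ltn0.
constructor => c bc.
have ac := le_trans ab (ltm_deg bc); apply: IHk => //.
rewrite ltnS in bk; apply: leq_trans bk; apply: proper_card.
apply/properP; split.
  by apply/fintype.subsetP => x; rewrite !inE; apply: ltm_trans.
by exists (BMultinom (hN _ ac)); rewrite !inE //= ltmm.
Qed.

(** The floor d on the degree excludes infinite descent; this serves the termination of the
    algorithm. *)
Lemma wf_ltm_down d : well_founded (fun a b => lt a b && (d <= deg a)).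
Proof.
move=> a; have [N hN] := mdeg_bounded d.
pose card b := #|[pred c : 'X_{1..n < N} | lt c b]|.
have [k] := ubnP (card a); elim: k a => [a|k IHk a ak]; first by rewrite ltn0.
constructor=> b /andP[ba db]; apply: IHk; rewrite ltnS in ak.
apply: leq_trans ak; apply: proper_card; apply/properP; split.
  by apply/fintype.subsetP => x; rewrite !inE => xb; apply: ltm_trans ba.
by exists (BMultinom (hN _ db)); rewrite !inE //= ltmm.
Qed.

Lemma ltm_max (P : 'X_{1..n} -> Prop) : (exists a, P a) ->
  exists2 a, P a & forall b, P b -> b = a \/ lt b a.
Proof.
move=> [a]; elim/(well_founded_ind wf_ltm_up): a => a IHa Pa.
have [[b [ab Pb]]|h] := pselect (exists b, lt a b /\ P b); first exact: IHa Pb.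
exists a => // b Pb; have [->|ba] := eqVneq b a; first by left.
by right; case/orP: (ltm_total ba) => // ab; case: h; exists b.
Qed.

(** Locality: by [mdeg_le_deg] the only exponent of nonnegative degree is 0, so proper multiples
    have smaller degree. *)
Lemma lem_ltm a b : (a <= b)%MM -> b = a \/ lt b a.
Proof.
move=> ab; have [->|ba] := eqVneq b a; [by left|right].
rewrite -(submK ab) -[X in lt _ X]add0m; apply: ltmD2r; apply: deg_lt.
have [M hM] := mdeg_le_deg; have := hM (b - a)%MM; rewrite deg0 => h.
rewrite ltNge; apply/negP => d0.
have : (mdeg (b - a))%:R <= 0 :> rat.
  by apply: le_trans h _; rewrite mulr_ge0_le0 ?ler0n // oppr_le0.
rewrite lern0 mdeg_eq0 => /eqP e; case/eqP: ba.
by rewrite -(submK ab) e add0m.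
Qed.

Lemma ltmUD i a : lt (a + U_(i))%MM a.
Proof. by apply: deg_lt; rewrite degD gtrDl degU_lt0. Qed.

End LocalOrdering.
(** * Coefficientwise description of the adic filtrations *)

Section Vanishing.
Context (K : fieldType) (m n : nat).
Implicit Types (p q : Ksx K m n) (a : 'X_{1..m}) (b : 'X_{1..n}).
Implicit Types (S : 'X_{1..m} -> 'X_{1..n} -> Prop).

Lemma ksxP p q : (forall a b, p b a = q b a) -> p = q.
Proof. by move=> h; apply: fpsP => b; apply: fpsP => a. Qed.

Lemma scoefE p a b : scoef p a b = p b a. Proof. by []. Qed.

Lemma ksxDE p q a b : (p + q) b a = p b a + q b a. Proof. by []. Qed.

Lemma ksxBE p q a b : (p - q) b a = p b a - q b a. Proof. by []. Qed.

Definition vanish S p := forall a b, S a b -> p b a = 0.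

(** S is the set of exponents outside a monomial ideal; this is what makes the series vanishing on S
    an ideal. *)
Definition divisor_closed S := forall a b a' b',
  (a' <= a)%MM -> (b' <= b)%MM -> S a b -> S a' b'.

Lemma ksx_mul_eq0 p q a b : (forall a1 a2 b1 b2, a = (a1 + a2)%MM ->
  b = (b1 + b2)%MM -> p b1 a1 * q b2 a2 = 0) -> (p * q) b a = 0.
Proof.
move=> h; rewrite fpsME fps_sumE big1 // => k /eqP bk.
apply: fps_mul_eq0 => a1 a2 ak.
exact: h.
Qed.

Lemma vanishD S p q : vanish S p -> vanish S q -> vanish S (p + q).
Proof. by move=> hp hq a b ab; rewrite !fpsDE hp ?hq ?addr0. Qed.

Lemma vanishN S p : vanish S p -> vanish S (- p).
Proof. by move=> hp a b ab; rewrite !fpsNE hp ?oppr0. Qed.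

Lemma vanishB S p q : vanish S p -> vanish S q -> vanish S (p - q).
Proof. by move=> hp hq; apply/vanishD/vanishN. Qed.

Lemma vanish_sum S (I : Type) (s : seq I) (P : pred I) (G : I -> Ksx K m n) :
  (forall i, P i -> vanish S (G i)) -> vanish S (\sum_(i <- s | P i) G i).
Proof.
by move=> h; elim/big_ind: _ => [|p q|i Pi]; [|exact: vanishD|exact: h].
Qed.

Lemma vanishM S p q : divisor_closed S -> vanish S q -> vanish S (p * q).
Proof.
move=> Sd hq a b ab; apply: ksx_mul_eq0 => a1 a2 b1 b2 aE bE.
rewrite hq ?mulr0 //; apply: Sd ab; first by rewrite aE lem_addl.
by rewrite bE lem_addl.
Qed.

Definition smon (u : K) a b : Ksx K m n := (u *: fpsX a) *: fpsX b.

Lemma smonE u a b a' b' :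
  smon u a b b' a' = if (a' == a) && (b' == b) then u else 0.
Proof.
rewrite /smon fpsZE mulrC fpsXE; case: (b' == b); last first.
  by rewrite mul0r andbF.
by rewrite mul1r fpsZE fpsXE andbT; case: eqP; rewrite ?mulr1 ?mulr0.
Qed.

Lemma smonM u a b p a' b' : (smon u a b * p) b' a' =
  if (a <= a')%MM && (b <= b')%MM then u * p (b' - b)%MM (a' - a)%MM else 0.
Proof.
rewrite /smon -scalerAl fpsZE -scalerAl fpsZE fpsXM fpsXM.
by case: (a <= a')%MM; case: (b <= b')%MM; rewrite /= ?mulr0.
Qed.

Lemma smon_mul u v a b a' b' :
  smon u a b * smon v a' b' = smon (u * v) (a + a')%MM (b + b')%MM.
Proof.
apply: ksxP => x y; rewrite smonM !smonE -!subm_eq.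
case: (a <= x)%MM; case: (b <= y)%MM; rewrite //= ?andbF //.
by case: ifP; rewrite ?mulr0.
Qed.

Lemma vanish_mul_weight (w : 'X_{1..m} -> 'X_{1..n} -> nat) i j p q :
  (forall a b a' b', w (a + a')%MM (b + b')%MM = w a b + w a' b')%N ->
  vanish (fun a b => w a b < i)%N p -> vanish (fun a b => w a b < j)%N q ->
  vanish (fun a b => w a b < i + j)%N (p * q).
Proof.
move=> wD hp hq a b ab; apply: ksx_mul_eq0 => a1 a2 b1 b2 aE bE.
have [h|h] := ltnP (w a1 b1) i; first by rewrite hp ?mul0r.
have [h'|h'] := ltnP (w a2 b2) j; first by rewrite hq ?mulr0.
by move: ab; rewrite aE bE wD; lia.
Qed.

(* Powers of an ideal generated by the monomials (ea j, eb j), all of weight 1. *)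
Section IdealPowers.
Context (J : finType) (ea : J -> 'X_{1..m}) (eb : J -> 'X_{1..n}).
Context (w : 'X_{1..m} -> 'X_{1..n} -> nat) (I : set (Ksx K m n)).
Hypothesis wD : forall a b a' b',
  (w (a + a')%MM (b + b')%MM = w a b + w a' b')%N.
Hypothesis w_gen : forall j, w (ea j) (eb j) = 1%N.
Hypothesis w_div : forall a b, (0 < w a b)%N ->
  exists j, (ea j <= a)%MM && (eb j <= b)%MM.
Hypothesis I_gen : forall j, I (smon 1 (ea j) (eb j)).
Hypothesis I_w : forall p, I p -> vanish (fun a b => w a b < 1)%N p.

Let w_closed N : divisor_closed (fun a b => w a b < N)%N.
Proof.
move=> a b a' b' aa bb; rewrite -(submK aa) -(submK bb) wD; lia.
Qed.

(** Each term is credited to one generator dividing it, selected by [fst], so that none is counted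
    twice. The series [q j] collects the terms credited to j, divided by that generator, and has
    weight one lower. Finitely many generators thus suffice for infinitely many terms. *)
Lemma vanish_ideal_exp N p :
  vanish (fun a b => w a b < N)%N p -> ideal_exp I N p.
Proof.
elim: N p => [|N IHN] p hp; first exact: ideal_exp0.
pose fst a b := [pick j | (ea j <= a)%MM && (eb j <= b)%MM].
pose q j : Ksx K m n := Fps (fun b => Fps (fun a =>
  if fst (a + ea j)%MM (b + eb j)%MM == Some j then p (b + eb j)%MM (a + ea j)%MM
  else 0)).
have -> : p = \sum_j smon 1 (ea j) (eb j) * q j.
  apply: ksxP => a b; rewrite !fps_sumE.
  case E : (fst a b) => [j|]; last first.
    rewrite big1 => [|j _]; last first.
      rewrite smonM; case: ifP => // ab.
      by move: E; rewrite /fst; case: pickP => // /(_ j); rewrite ab.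
    apply: hp; rewrite ltnS leqNgt; apply/negP => w0; move: E; rewrite /fst.
    case: pickP => // h _; have [|j] := @w_div a b; first exact: leq_ltn_trans w0.
    by rewrite h.
  have ab : (ea j <= a)%MM && (eb j <= b)%MM.
    by move: E; rewrite /fst; case: pickP => // i + [<-].
  rewrite (bigD1 j) // big1 => [|i /andP[_ ij]]; rewrite smonM /=; last first.
    case: ifP => // /andP[h1 h2]; rewrite !submK // E.
    case: (Some j =P Some i) => [[ji]|_]; last by rewrite mulr0.
    by rewrite ji eqxx in ij.
  by rewrite ab; case/andP: ab => h1 h2; rewrite !submK // E eqxx mul1r addr0.
apply: ideal_span_sum => j; apply: ideal_expS => //; apply: IHN => a b ab /=.
by case: ifP => // _; apply: hp; rewrite wD w_gen addn1.
Qed.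

Lemma ideal_exp_vanish N p :
  ideal_exp I N p -> vanish (fun a b => w a b < N)%N p.
Proof.
apply: ideal_span_ind => [q [f [fI ->]]|||].
- elim: N f fI => [|N IHN] f fI; first by move=> ?.
  rewrite big_ord_recl; apply: (@vanish_mul_weight w 1 N) => //.
    exact: I_w.
  exact: IHN.
- by [].
- by move=> *; apply: vanishD.
- by move=> *; apply: vanishM.
Qed.

End IdealPowers.

(** The exponents outside <s>^N and, for [lowSX], outside <s,x>^N. *)
Definition lowS N a b := (mdeg a < N)%N.
Definition lowSX N a b := (mdeg a + mdeg b < N)%N.

Lemma lowS_closed N : divisor_closed (lowS N).
Proof. by move=> a b a' b' aa bb; rewrite /lowS -(submK aa) mdegD; lia. Qed.

Lemma lowSX_closed N : divisor_closed (lowSX N).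
Proof.
by move=> a b a' b' aa bb; rewrite /lowSX -(submK aa) -(submK bb) !mdegD; lia.
Qed.

Lemma lowSX_le M N p : (M <= N)%N -> vanish (lowSX N) p -> vanish (lowSX M) p.
Proof. by move=> MN h a b ab; apply: h; apply: leq_trans ab MN. Qed.

Lemma svarE j : svar j = smon 1 U_(j)%MM 0%MM.
Proof. by rewrite /smon scale1r. Qed.

Lemma xvarE i : xvar i = smon 1 0%MM U_(i)%MM.
Proof. by rewrite /smon !scale1r. Qed.

Lemma mdeg_gt0_dvd k (a : 'X_{1..k}) : (0 < mdeg a)%N ->
  exists j, (U_(j) <= a)%MM.
Proof.
move=> a0; have [j aj] : exists j, (0 < a j)%N.
  apply: contrapT => h; move: a0; rewrite lt0n mdeg_eq0 => /eqP; apply.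
  apply/mnmP => i; rewrite mnm0E.
  by case: (posnP (a i)) => // ai; case: h; exists i.
by exists j; apply/mnm_lepP => i; rewrite mnm1E; case: eqP => // <-.
Qed.

Lemma smon_gen_vanish (w : 'X_{1..m} -> 'X_{1..n} -> nat) u a b :
  (0 < w a b)%N -> vanish (fun a b => w a b < 1)%N (smon u a b).
Proof.
move=> w0 a' b'; rewrite smonE.
by case: eqP => //= ->; case: eqP => //= ->; lia.
Qed.

Lemma sideal_expP N p : ideal_exp (@sideal K m n) N p <-> vanish (lowS N) p.
Proof.
have wD (a : 'X_{1..m}) (b : 'X_{1..n}) a' (b' : 'X_{1..n}) :
  (mdeg (a + a')%MM = mdeg a + mdeg a')%N by exact: mdegD.
split.
  apply: (@ideal_exp_vanish (fun a b => mdeg a)) => // q; apply: ideal_span_ind.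
  - by move=> _ [j _ <-]; rewrite svarE; apply: smon_gen_vanish; rewrite mdeg1.
  - by [].
  - by move=> *; apply: vanishD.
  - by move=> *; apply: vanishM => //; apply: (@lowS_closed 1).
apply: (@vanish_ideal_exp _ (fun j => U_(j)%MM) (fun=> 0%MM)
  (fun a b => mdeg a)) => //.
- by move=> j; rewrite mdeg1.
- move=> a b /mdeg_gt0_dvd[j ja]; exists j; rewrite ja /=.
  by apply/mnm_lepP => i; rewrite mnm0E.
- by move=> j; rewrite -svarE; apply: ideal_span_gen; exists j.
Qed.

Lemma sxideal_expP N p : ideal_exp (@sxideal K m n) N p <-> vanish (lowSX N) p.
Proof.
pose w (a : 'X_{1..m}) (b : 'X_{1..n}) := (mdeg a + mdeg b)%N.
have wD a b a' b' : (w (a + a')%MM (b + b')%MM = w a b + w a' b')%N.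
  by rewrite /w !mdegD addnACA.
split.
  apply: (@ideal_exp_vanish w) => // q; apply: ideal_span_ind.
  - move=> _ [] [j _ <-]; rewrite (svarE, xvarE); apply: smon_gen_vanish;
    by rewrite /w ?mdeg0 mdeg1.
  - by [].
  - by move=> *; apply: vanishD.
  - by move=> *; apply: vanishM => //; apply: (@lowSX_closed 1).
apply: (@vanish_ideal_exp ('I_m + 'I_n)%type
  (fun j => if j is inl i then U_(i)%MM else 0%MM)
  (fun j => if j is inr i then U_(i)%MM else 0%MM) w) => //.
- by move=> [] j; rewrite /w mdeg0 mdeg1.
- have le0 k (c : 'X_{1..k}) : (0 <= c)%MM by apply/mnm_lepP => i; rewrite mnm0E.
  move=> a b; rewrite /w; have [a0|] := posnP (mdeg a).
    by rewrite a0 => /mdeg_gt0_dvd[j jb]; exists (inr j); rewrite jb le0.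
  by move=> /mdeg_gt0_dvd[j ja] _; exists (inl j); rewrite ja le0.
- move=> [] j; rewrite -(svarE, xvarE); apply: ideal_span_gen.
    by left; exists j.
  by right; exists j.
Qed.

End Vanishing.
(** * Leading terms *)

Section Leading.
Context (K : fieldType) (m n : nat).
Context (degs : 'X_{1..m} -> rat) (lts : rel 'X_{1..m}).
Context (degx : 'X_{1..n} -> rat) (ltx : rel 'X_{1..n}).
Hypotheses (lts_ord : local_degree_ordering degs lts).
Hypotheses (ltx_ord : local_degree_ordering degx ltx).
Implicit Types (p : Ksx K m n) (a : 'X_{1..m}) (b : 'X_{1..n}).

Definition is_xlead (h : {fps K[n]}) b :=
  h b != 0 /\ forall b', h b' != 0 -> b' = b \/ ltx b' b.

Lemma xlead_exists (h : {fps K[n]}) : h != 0 -> exists b, is_xlead h b.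
Proof.
move=> h0; have [|b hb bmax] := ltm_max ltx_ord (P := fun b => h b != 0).
  apply: contrapT => hn; case/eqP: h0; apply: fpsP => b.
  by apply/eqP; apply: contrapT => /negP hb; apply: hn; exists b.
by exists b.
Qed.

Lemma xleadE (h : {fps K[n]}) b : is_xlead h b -> xlead ltx h = h b *: fpsX b.
Proof.
move=> [hb bmax]; apply: xget_unique => [|_ [c [hc cmax ->]]]; first by exists b.
have [->//|bc] := cmax _ hb; have [->//|cb] := bmax _ hc.
by have := ltm_trans ltx_ord bc cb; rewrite (ltmm ltx_ord).
Qed.

Definition is_lead p a b := p b a != 0 /\
  forall a' b', p b' a' != 0 ->
    (a', b') = (a, b) \/ block_lt lts ltx (a', b') (a, b).

Lemma lead_exists p : p != 0 -> exists a b, is_lead p a b.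
Proof.
move=> p0.
have [|a [b0 pab0] amax] := ltm_max lts_ord (P := fun a => exists b, p b a != 0).
  apply: contrapT => hn; case/eqP: p0; apply: ksxP => a b.
  by apply/eqP; apply: contrapT => /negP hb; apply: hn; exists a, b.
have [|b pab bmax] := ltm_max ltx_ord (P := fun b => p b a != 0).
  by exists b0.
exists a, b; split=> // a' b' pab'.
have [|aE|aa] := amax a'; first by exists b'.
  2: by right; rewrite /block_lt /= aa.
rewrite {}aE in pab' *; have [->|bb] := bmax _ pab'; [by left|right].
by rewrite /block_lt /= eqxx bb orbT.
Qed.

Lemma block_lt_asym a b a' b' : block_lt lts ltx (a, b) (a', b') ->
  block_lt lts ltx (a', b') (a, b) -> False.
Proof.
rewrite /block_lt /= => /orP[h|/andP[/eqP-> h]] /orP[h'|/andP[/eqP h'' h']].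
- by have := ltm_trans lts_ord h h'; rewrite (ltmm lts_ord).
- by rewrite h'' (ltmm lts_ord) in h.
- by rewrite (ltmm lts_ord) in h'.
- by have := ltm_trans ltx_ord h h'; rewrite (ltmm ltx_ord).
Qed.

Lemma leadE p a b : is_lead p a b -> lead lts ltx p = smon (p b a) a b.
Proof.
move=> [pab abmax]; apply: xget_unique => [|_ [a' [b' [pab' abmax' ->]]]].
  by exists a, b.
have [[-> ->]//|h] := abmax' _ _ pab; have [[-> ->]//|h'] := abmax _ _ pab'.
by case: (block_lt_asym h h').
Qed.

Lemma sleadE p a b : is_lead p a b -> forall a' b',
  slead lts p b' a' = if a' == a then p b' a' else 0.
Proof.
move=> [pab abmax].
have scoef_neq0 a' : scoef p a' != 0 -> exists b', p b' a' != 0.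
  move=> pa; apply: contrapT => hn; case/eqP: pa; apply: fpsP => b'.
  by apply/eqP; apply: contrapT => /negP hb; apply: hn; exists b'.
have pa : scoef p a != 0.
  by apply: contraNneq pab => /(congr1 (fun h : {fps K[n]} => h b)) /= ->.
have amax a' : scoef p a' != 0 -> a' = a \/ lts a' a.
  move=> /scoef_neq0[b' /abmax[[-> _]|]]; first by left.
  by rewrite /block_lt /= => /orP[|/andP[/eqP]]; [right|left].
have -> : slead lts p = fpsX a *: xemb m (scoef p a).
  apply: xget_unique => [|_ [c [hc cmax ->]]]; first by exists a.
  have [->//|bc] := cmax _ pa; have [->//|cb] := amax _ hc.
  by have := ltm_trans lts_ord bc cb; rewrite (ltmm lts_ord).
move=> a' b'; rewrite fpsZE mulrC -scalerAl mul1r fpsZE fpsXE.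
by case: (a' =P a) => [->|_]; rewrite ?mulr1 ?mulr0.
Qed.

Lemma setmax_smon u a b : u != 0 ->
  setmax (termdegs degs degx (smon u a b : Ksx K m n)) = degs a + degx b.
Proof.
move=> u0; have tE d : termdegs degs degx (smon u a b) d <-> d = degs a + degx b.
  split=> [[a' [b' [h ->]]]|->]; last by exists a, b; rewrite smonE !eqxx.
  by move: h; rewrite smonE; case: ifP => [/andP[/eqP-> /eqP->]|_]; rewrite ?eqxx.
apply: xget_unique => [|d [/tE]//]; split; first exact/tE.
by move=> d /tE ->.
Qed.

Context (r : nat) (D : 'M[diffop K m n]_(m, r)).

(** The choice of q_0 depends on leading terms and is not additive; this weaker condition on single
    terms is stable under sums, hence holds for the whole third component of NF(p, k). *)
Definition small_terms (k : int) p := forall a b, p b a != 0 ->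
  (absz k <= mdeg a)%N \/ degs a + degx b < NK degs degx D k.

Notation q0 := (NF_q0 degs degx lts ltx D).

Lemma is_lead_max p a b : is_lead p a b -> forall b', p b' a != 0 ->
  b' = b \/ ltx b' b.
Proof.
move=> [_ h] b' /h[[->]|]; first by left.
by rewrite /block_lt /= (ltmm lts_ord) eqxx; right.
Qed.

Lemma NF_q0_stop k p : vanish (lowS (absz k)) p -> q0 k p = p.
Proof. by move=> /sideal_expP h; rewrite /NF_q0; case: asboolP. Qed.

Lemma NF_q0_lt k p a b : is_lead p a b -> ~ vanish (lowS (absz k)) p ->
  degs a + degx b < NK degs degx D k -> q0 k p = slead lts p.
Proof.
move=> pab hp hlt; rewrite /NF_q0; case: asboolP => [/sideal_expP//|_].
by case: asboolP => // -[]; left; rewrite (leadE pab) setmax_smon //; case: pab.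
Qed.

Lemma NF_q0_cases k p a b : is_lead p a b -> ~ vanish (lowS (absz k)) p ->
  q0 k p = slead lts p \/ q0 k p = 0.
Proof.
move=> pab hp; rewrite /NF_q0; case: asboolP => [/sideal_expP//|_].
by case: ifP; [left|right].
Qed.

(** All terms of lead_s(p) share one s-exponent, and among their x-exponents the leading one has the
    largest degree; a bound on deg lead(p) therefore bounds them all. *)
Lemma NF_q0_small k p : small_terms k (q0 k p).
Proof.
have [->|/lead_exists[a [b pab]]] := eqVneq p 0.
  by move=> a b; rewrite NF_q0_stop // fps0E eqxx.
rewrite /NF_q0; case: asboolP => [/sideal_expP hp|_] a' b'.
  move=> pab'; left; rewrite leqNgt; apply/negP => /(hp _ b') e.
  by rewrite e eqxx in pab'.
case: asboolP => [|_]; last by rewrite fps0E eqxx.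
rewrite (leadE pab) setmax_smon; last by case: pab.
rewrite (sleadE pab); case: (a' =P a) => [->|]; last by rewrite eqxx.
move=> [h|/sideal_expP h] pab'.
  right; apply: le_lt_trans h; rewrite lerD2l.
  by have [->//|/(ltm_deg ltx_ord)] := is_lead_max pab pab'.
left; rewrite leqNgt; apply/negP => aK; have [/eqP h0 _] := pab; apply: h0.
by have := h a b aK; rewrite (sleadE pab) eqxx.
Qed.

End Leading.
(** * Differential operators *)

Section Operators.
Context (K : fieldType) (m n : nat).
Implicit Types (p q : Ksx K m n) (a : 'X_{1..m}) (b c : 'X_{1..n}).
Implicit Types (P Q : diffop K m n).

Section DerivVanish.
Context (T : nat -> 'X_{1..m} -> 'X_{1..n} -> Prop).
Hypothesis T_deriv : forall N a b i, T N a b -> T N.+1 a (b + U_(i))%MM.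
Hypothesis T_le : forall N N' a b, (N <= N')%N -> T N a b -> T N' a b.
Hypothesis T_closed : forall N, divisor_closed (T N).

Lemma deriv_vanish N i p : vanish (T N.+1) p -> vanish (T N) (fps_deriv i p).
Proof.
move=> hp a b ab; rewrite /fps_deriv /= fpsMnE hp ?mul0rn //.
exact: T_deriv.
Qed.

Lemma derivm_vanish N c p :
  vanish (T (N + mdeg c)) p -> vanish (T N) (fps_derivm c p).
Proof.
rewrite mdegE -big_enum /= /fps_derivm.
elim: (enum 'I_n) N => [|i s IHs] N; first by rewrite big_nil addn0.
rewrite big_cons addnA => /IHs /= {IHs}.
elim: (c i) N => [|k IHk] N; first by rewrite addn0.
by rewrite -addSnnS => /IHk /=; apply: deriv_vanish.
Qed.

(** The family T is abstract in order to serve two filtrations: [lowSX], where each derivation costs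
    one degree, and a constant family depending on the s-exponent only, which x-derivations
    preserve. The size [msize P] exceeds the order by one, a harmless loss. *)
Lemma dact_vanish N P p : vanish (T (N + msize P)) p -> vanish (T N) (dact P p).
Proof.
move=> hp; rewrite /dact big_seq; apply: vanish_sum => c cP.
apply: vanishM => //; apply: derivm_vanish => a b ab; apply: hp.
by apply: T_le ab; rewrite leq_add2l ltnW // msize_mdeg_lt.
Qed.

End DerivVanish.

(** The supports of P, Q and P + Q differ; a common range of exponents makes [dact] visibly additive
    in the operator. *)
Lemma dact_sum_low d P p : (msize P <= d)%N ->
  dact P p = \sum_(c : 'X_{1..n < d}) dcoef P c * fps_derivm c p.
Proof.
move=> Pd; rewrite /dact (big_mksub 'X_{1..n < d}) /=; first last.
- by move=> c cP; apply: leq_trans Pd; apply: msize_mdeg_lt.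
- exact: msupp_uniq.
by rewrite big_rmcond //= => c /memN_msupp_eq0; rewrite /dcoef => ->; rewrite mul0r.
Qed.

Lemma dactD P Q p : dact (P + Q) p = dact P p + dact Q p.
Proof.
pose d := maxn (msize (P + Q)) (maxn (msize P) (msize Q)).
rewrite !(@dact_sum_low d); last 3 first.
- by rewrite /d; lia.
- by rewrite /d; lia.
- by rewrite /d; lia.
rewrite -big_split; apply: eq_bigr => c _ /=.
by rewrite -mulrDl /dcoef mcoeffD.
Qed.

Lemma dactZ q P p : dact (q *: P) p = q * dact P p.
Proof.
pose d := maxn (msize (q *: P)) (msize P).
rewrite !(@dact_sum_low d); last 2 first.
- by rewrite /d; lia.
- by rewrite /d; lia.
rewrite mulr_sumr; apply: eq_bigr => c _.
by rewrite mulrA /dcoef mcoeffZ.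
Qed.

Lemma dact0 p : dact (0 : diffop K m n) p = 0.
Proof. by rewrite /dact msupp0 big_nil. Qed.

Lemma dactN P p : dact (- P) p = - dact P p.
Proof. by apply: (addrI (dact P p)); rewrite -dactD !subrr dact0. Qed.

Lemma dact_sum (I : Type) (s : seq I) (G : I -> diffop K m n) p :
  dact (\sum_(i <- s) G i) p = \sum_(i <- s) dact (G i) p.
Proof.
elim: s => [|i s IHs]; first by rewrite !big_nil dact0.
by rewrite !big_cons dactD IHs.
Qed.

Lemma fps_derivm0 p : fps_derivm 0%MM p = p.
Proof.
rewrite /fps_derivm; elim: (enum _) => //= i s ->.
by rewrite mnm0E.
Qed.

Lemma dact_dop0 q p : dact (dop0 q) p = q * p.
Proof.
rewrite /dact /dop0 msuppC; case: eqP => [->|_].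
  by rewrite big_nil mul0r.
by rewrite big_seq1 fps_derivm0 /dcoef mcoeffC eqxx mulr1.
Qed.

Lemma xembE (f : {fps K[n]}) b : xemb m f b = f b *: 1.
Proof. by []. Qed.

Lemma xemb_mul (f h : {fps K[n]}) : xemb m (f * h) = xemb m f * xemb m h.
Proof.
apply: fpsP => b; rewrite xembE [in LHS]fpsME fpsME scaler_suml.
by apply: eq_bigr => k _; rewrite !xembE -scalerAl mul1r scalerA.
Qed.

Lemma xembD (f h : {fps K[n]}) : xemb m (f + h) = xemb m f + xemb m h.
Proof. by apply: fpsP => b; rewrite fpsDE !xembE scalerDl. Qed.

Lemma xemb0 : xemb m (0 : {fps K[n]}) = 0.
Proof. by apply: fpsP => b; rewrite xembE scale0r. Qed.

Lemma xemb_sum (I : Type) (s : seq I) (G : I -> {fps K[n]}) :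
  xemb m (\sum_(i <- s) G i) = \sum_(i <- s) xemb m (G i).
Proof. exact: (big_morph _ xembD xemb0). Qed.

Lemma xemb_mon u b : xemb m (u *: fpsX b : {fps K[n]}) = smon u 0%MM b.
Proof.
apply: ksxP => a' b'; rewrite smonE xembE !(fpsZE, fps1E, fpsXE).
by case: (b' == b); case: (a' == _); rewrite ?mulr1 ?mulr0 ?mul0r.
Qed.

Context (r : nat) (D : 'M[diffop K m n]_(m, r)).
Implicit Types v w z : 'cV[Ksx K m n]_r.

(** The hypothesis is entrywise because the column vectors are a module over K[[s,x]], not directly
    over K[[s]]. *)
Lemma sDact_linear (u : {fps K[m]}) v w z :
  (forall i, z i 0 = u *: v i 0 + w i 0) ->
  sDact D z = u *: sDact D v + sDact D w.
Proof.
move=> zE; rewrite /sDact scaler_sumr -big_split; apply: eq_bigr => j _ /=.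
under eq_bigr => i _ do rewrite zE dact_linear.
by rewrite big_split -scaler_sumr mulrDr mulrC -scalerAl mulrC.
Qed.

Lemma sDact_eq0 v : (forall i, v i 0 = 0) -> sDact D v = 0.
Proof.
move=> v0; have := @sDact_linear (-1) v v v.
by rewrite scaleN1r addNr; apply=> i; rewrite v0 scaler0 addr0.
Qed.

Lemma Fop_act (f : 'rV[{fps K[n]}]_r) v :
  \sum_i dact (Fop f D 0 i) (v i 0) =
  \sum_i xemb m (f 0 i) * v i 0 - sDact D v.
Proof.
rewrite /sDact; under [X in _ - X]eq_bigr => j _ do rewrite mulr_sumr.
rewrite exchange_big /= -sumrB; apply: eq_bigr => i _.
rewrite mxE dactD dactN dact_dop0 dact_sum; congr (_ - _).
by apply: eq_bigr => j _; rewrite dactZ.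
Qed.

Lemma sDact_lowSX : exists C, forall N v,
  (forall i, vanish (lowSX (N + C)) (v i 0)) -> vanish (lowSX N) (sDact D v).
Proof.
(* A crude bound for the orders of all entries of D at once; multiplication by series and by s_j
   never lowers the adic order. *)
exists (\sum_j \sum_i msize (D j i))%N => N v hv.
apply: vanish_sum => j _; apply: vanishM; first exact: lowSX_closed.
apply: vanish_sum => i _; apply: (@dact_vanish (fun N => lowSX N)).
- by move=> N' a b i'; rewrite /lowSX mdegD mdeg1; lia.
- by move=> N' N'' a b NN; rewrite /lowSX => h; apply: leq_trans h NN.
- exact: lowSX_closed.
apply: lowSX_le (hv i); rewrite leq_add2l (bigD1 j) //= (bigD1 i) //=.
by rewrite -addnA leq_addr.
Qed.

(** The factor s_j shifts the s-exponent: the coefficient at s^a only involves v at divisors of a -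
    U_(j), all of which lie strictly above a, since derivations in x leave s-exponents alone. *)
Lemma sDact_coef_eq0 (degs : 'X_{1..m} -> rat) (lts : rel 'X_{1..m}) v a b :
  local_degree_ordering degs lts ->
  (forall i, vanish (fun a' _ => lts a a') (v i 0)) -> sDact D v b a = 0.
Proof.
move=> lts_ord hv; rewrite /sDact !fps_sumE big1 // => j _.
rewrite svarE smonM; case: ifP => // /andP[ja _]; rewrite mul1r.
have cl : divisor_closed (fun a' (_ : 'X_{1..n}) => lts a a').
  move=> a1 b1 a2 b2 aa _ h.
  by have [<-//|h'] := lem_ltm lts_ord aa; apply: (ltm_trans lts_ord) h h'.
have : vanish (fun a' _ => lts a a') (\sum_i dact (D j i) (v i 0)).
  apply: vanish_sum => i _.
  by apply: (@dact_vanish (fun _ a' _ => lts a a') _ _ (fun=> cl) 0).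
by apply; rewrite -{1}(submK ja); apply: ltmUD lts_ord _ _.
Qed.

End Operators.
(** * Unitriangular maps for the block ordering *)

Section BlockOrder.
Context (m n : nat).
Context (degs : 'X_{1..m} -> rat) (lts : rel 'X_{1..m}).
Context (degx : 'X_{1..n} -> rat) (ltx : rel 'X_{1..n}).
Hypotheses (lts_ord : local_degree_ordering degs lts).
Hypotheses (ltx_ord : local_degree_ordering degx ltx).

Lemma wf_block_up : well_founded (fun x y => block_lt lts ltx y x).
Proof.
move=> [a b]; elim/(well_founded_ind (wf_ltm_up lts_ord)): a b => a IHa b.
elim/(well_founded_ind (wf_ltm_up ltx_ord)): b => b IHb.
constructor=> -[a' b']; rewrite /block_lt /= => /orP[/IHa|/andP[/eqP <-]].
  exact.
exact: IHb.
Qed.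

(** Only finitely many exponents have total degree below N, so monotone pointwise bounds have a
    common maximum. *)
Lemma low_bound N (P : 'X_{1..m} -> 'X_{1..n} -> nat -> Prop) :
  (forall a b M M', (M <= M')%N -> P a b M -> P a b M') ->
  (forall a b, exists M, P a b M) ->
  exists M, forall a b, lowSX N a b -> P a b M.
Proof.
move=> Pmono Pex.
have [f fP] : {f : 'X_{1..m} * 'X_{1..n} -> nat & forall x, P x.1 x.2 (f x)}.
  by apply: (@boolp.choice _ _ (fun x => P x.1 x.2)) => -[a b]; apply: Pex.
exists (\max_(x : 'X_{1..m < N} * 'X_{1..n < N}) f (val x.1, val x.2)).
move=> a b; rewrite /lowSX => ab.
have aN : (mdeg a < N)%N by lia.
have bN : (mdeg b < N)%N by lia.
apply: Pmono (fP (a, b)).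
exact: (leq_bigmax (BMultinom aN, BMultinom bN)).
Qed.

End BlockOrder.

Section Triangular.
Context (K : fieldType) (m n : nat).
Context (degs : 'X_{1..m} -> rat) (lts : rel 'X_{1..m}).
Context (degx : 'X_{1..n} -> rat) (ltx : rel 'X_{1..n}).
Hypotheses (lts_ord : local_degree_ordering degs lts).
Hypotheses (ltx_ord : local_degree_ordering degx ltx).
Implicit Types (p q z : Ksx K m n) (a : 'X_{1..m}) (b : 'X_{1..n}).
Context (phi : Ksx K m n -> Ksx K m n).
Hypothesis phiB : forall p q, phi (p - q) = phi p - phi q.
Hypothesis phi_triangular : forall z a b,
  (forall a' b', block_lt lts ltx (a, b) (a', b') -> z b' a' = 0) ->
  phi z b a = z b a.

Let phiD p q : phi (p + q) = phi p + phi q.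
Proof.
have phi0 : phi 0 = 0 by have := phiB 0 0; rewrite !subrr.
have phiN t : phi (- t) = - phi t by rewrite -sub0r phiB phi0 sub0r.
by rewrite -{1}[q]opprK phiB phiN opprK.
Qed.

Lemma triangular_eq0 z : phi z = 0 -> z = 0.
Proof.
move=> hz; suff h x : z x.2 x.1 = 0 by apply: ksxP => a b; apply: (h (a, b)).
elim/(well_founded_ind (wf_block_up lts_ord ltx_ord)): x => -[a b] IH /=.
by rewrite -phi_triangular ?hz // => a' b' /IH.
Qed.

Lemma triangular_surj p : exists z, phi z = p.
Proof.
pose R (x y : 'X_{1..m} * 'X_{1..n}) := block_lt lts ltx y x : Prop.
have [mk mkE] : exists mk : ('X_{1..m} * 'X_{1..n} -> K) -> Ksx K m n,
    forall f a b, mk f b a = f (a, b).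
  by exists (fun f => Fps (fun b => Fps (fun a => f (a, b)))).
(* The coefficient at x corrects p by the effect of the coefficients already found above x. As [phi]
   needs a full series, [pselect] extends these by 0. *)
pose step (x : 'X_{1..m} * 'X_{1..n}) (f : forall y, R y x -> K) : K :=
  p x.2 x.1 - phi (mk (fun y =>
    if pselect (R y x) is left h then f y h else 0)) x.2 x.1.
have [f fE] : exists f, forall x, f x = step x (fun y _ => f y).
  exists (Fix (wf_block_up lts_ord ltx_ord) (fun=> K : Type) step).
  apply: (Fix_eq (wf_block_up lts_ord ltx_ord) (fun=> K : Type) step).
  move=> y f1 f2 f12; rewrite /step.
  suff -> : (fun t => if pselect (R t y) is left h then f1 t h else 0) =
            (fun t => if pselect (R t y) is left h then f2 t h else 0) by [].
  by apply: funext => t; case: pselect.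
exists (mk f); apply: ksxP => a b.
pose up := mk (fun y => if pselect (R y (a, b)) is left _ then f y else 0).
have {}fE : f (a, b) = p b a - phi up b a by exact: (fE (a, b)).
(* The series [up] is the part of the solution above (a, b); [mk f - up] vanishes there, so
   triangularity evaluates its image at (a, b). *)
have mkfE : mk f = (mk f - up) + up by rewrite subrK.
rewrite mkfE phiD (ksxDE (phi _)) phi_triangular.
  rewrite (ksxBE (mk f)) mkE fE mkE; case: pselect => [h|_].
    by case: (block_lt_asym lts_ord ltx_ord h h).
  by rewrite subr0 subrK.
move=> a' b' h; rewrite (ksxBE (mk f)) !mkE; case: pselect => // _.
by rewrite subrr.
Qed.

(** Since infinitely many exponents may lie above (a, b), the induction hypothesis alone yields no
    common M. The bounded loss C repairs this: terms of z of total degree at least N' + C do not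
    reach the coefficient of [phi z] at (a, b), and [low_bound] treats the finitely many others. *)
Lemma triangular_inv_cont :
  (exists C, forall N z, vanish (lowSX (N + C)) z -> vanish (lowSX N) (phi z)) ->
  forall N, exists M, forall z,
  vanish (lowSX M) (phi z) -> vanish (lowSX N) z.
Proof.
move=> [C hC] N.
suff h (x : 'X_{1..m} * 'X_{1..n}) :
    exists M, forall z, vanish (lowSX M) (phi z) -> z x.2 x.1 = 0.
  have [||M hM] := @low_bound m n N
      (fun a b M => forall z, vanish (lowSX M) (phi z) -> z b a = 0).
  - by move=> a b M M' MM h' z hz; apply/h'/(lowSX_le MM hz).
  - by move=> a b; apply: (h (a, b)).
  by exists M => z hz a b ab; apply: hM hz.
elim/(well_founded_ind (wf_block_up lts_ord ltx_ord)): x => -[a b] IH /=.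
pose N' := (mdeg a + mdeg b).+1.
have [||M hM] := @low_bound m n (N' + C)
    (fun a' b' M => block_lt lts ltx (a, b) (a', b') -> forall z,
       vanish (lowSX M) (phi z) -> z b' a' = 0).
- by move=> a' b' M M' MM h' ab z hz; apply/h'/(lowSX_le MM hz).
- move=> a' b'; case: (boolP (block_lt lts ltx (a, b) (a', b'))) => [h|_].
    by have [M hM] := IH _ h; exists M.
  by exists 0%N.
exists (maxn M N') => z hz.
have zM := lowSX_le (leq_maxl M N') hz; have zN := lowSX_le (leq_maxr M N') hz.
pose low : Ksx K m n := Fps (fun b => Fps (fun a =>
  if (mdeg a + mdeg b < N' + C)%N then z b a else 0)).
have hi : vanish (lowSX (N' + C)) (z - low).
  by move=> a' b' ab'; rewrite ksxBE /= ifT ?subrr.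
have ab : lowSX N' a b by rewrite /lowSX.
have lowE : low b a = z b a by rewrite /= ifT // ltn_addr.
rewrite -lowE -phi_triangular => [|a' b' h /=].
  rewrite -[low](subKr z) phiB ksxBE zN // (hC _ _ hi) //.
  by rewrite subr0.
by case: ifP => // ab'; apply: hM h _ zM.
Qed.

End Triangular.

(** * Division by the standard basis *)

Section Division.
Context (K : fieldType) (m n r l : nat).
Context (degs : 'X_{1..m} -> rat) (lts : rel 'X_{1..m}).
Context (degx : 'X_{1..n} -> rat) (ltx : rel 'X_{1..n}).
Hypotheses (lts_ord : local_degree_ordering degs lts).
Hypotheses (ltx_ord : local_degree_ordering degx ltx).
Context (D : 'M[diffop K m n]_(m, r)).
Context (g : 'rV[{fps K[n]}]_l) (U : 'M[{fps K[n]}]_(r, l)).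
Context (L : 'I_l -> 'X_{1..n}).
Hypothesis gL : forall j, is_xlead ltx (g 0 j) (L j).
Implicit Types (p q z : Ksx K m n) (a : 'X_{1..m}) (b : 'X_{1..n}).

Notation lc j := (g 0 j (L j)).

Definition first_div b (j : 'I_l) :=
  (L j <= b)%MM && [forall j' : 'I_l, (j' < j)%N ==> ~~ (L j' <= b)%MM].

Definition reducible b := [exists j, (L j <= b)%MM].

Lemma first_div_uniq b i j : first_div b i -> first_div b j -> i = j.
Proof.
move=> /andP[bi /forallP hi] /andP[bj /forallP hj]; apply: val_inj.
case: (ltngtP i j) => // ij.
  by have := hj i; rewrite ij bi.
by have := hi j; rewrite ij bj.
Qed.

Lemma first_div_exists b : reducible b -> exists j, first_div b j.
Proof.
move=> /existsP[j bj]; have [N] := ubnP (val j); elim: N j bj => // N IHN j bj jN.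
have [h|] := boolP (first_div b j); first by exists j.
rewrite /first_div bj /= negb_forall => /existsP[i].
rewrite negb_imply negbK => /andP[ij bi]; apply: IHN bi _; exact: leq_trans ij jN.
Qed.

Definition irred_part z : Ksx K m n :=
  Fps (fun b => if reducible b then 0 else z b).

Definition quotient z (j : 'I_l) : Ksx K m n :=
  Fps (fun b => if first_div (b + L j)%MM j then (lc j)^-1 *: z (b + L j)%MM
                else 0).

Definition lift_quotient z : 'cV[Ksx K m n]_r :=
  \col_i \sum_j xemb m (U i j) * quotient z j.

(* A series z stores a pair (remainder, quotients): the terms of z at
   irreducible monomials form the remainder, a reducible term is credited to
   the first g_j whose leading monomial divides it.  [recompose z] is the
   series which has this remainder and these quotients. *)
Definition recompose z : Ksx K m n :=
  irred_part z + \sum_j xemb m (g 0 j) * quotient z j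
  - sDact D (lift_quotient z).

Lemma irred_partE z b : irred_part z b = if reducible b then 0 else z b.
Proof. by []. Qed.

Lemma quotientE z j b : quotient z j b =
  if first_div (b + L j)%MM j then (lc j)^-1 *: z (b + L j)%MM else 0.
Proof. by []. Qed.

Lemma irred_part_linear (u : {fps K[m]}) p q :
  irred_part (u *: p + q) = u *: irred_part p + irred_part q.
Proof.
by apply: fpsP => b /=; case: ifP => //; rewrite mulr0 addr0.
Qed.

Lemma quotient_linear (u : {fps K[m]}) p q j :
  quotient (u *: p + q) j = u *: quotient p j + quotient q j.
Proof.
apply: fpsP => b /=; case: ifP => _; last by rewrite mulr0 addr0.
by rewrite scalerDr [u * (_ *: _)]mulrC -scalerAl [_ * u]mulrC.
Qed.

Lemma irred_partD p q : irred_part (p + q) = irred_part p + irred_part q.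
Proof. by rewrite -{1}[p]scale1r irred_part_linear scale1r. Qed.

Lemma irred_partB p q : irred_part (p - q) = irred_part p - irred_part q.
Proof. by rewrite -[p - q]addrC -scaleN1r irred_part_linear scaleN1r addrC. Qed.

Lemma quotientB p q j : quotient (p - q) j = quotient p j - quotient q j.
Proof. by rewrite -[p - q]addrC -scaleN1r quotient_linear scaleN1r addrC. Qed.

Lemma quotientD p q j : quotient (p + q) j = quotient p j + quotient q j.
Proof. by rewrite -{1}[p]scale1r quotient_linear scale1r. Qed.

Lemma recompose_linear (u : {fps K[m]}) p q :
  recompose (u *: p + q) = u *: recompose p + recompose q.
Proof.
rewrite /recompose irred_part_linear.
rewrite (@sDact_linear _ _ _ _ D u (lift_quotient p) (lift_quotient q));
  last first.
  move=> i; rewrite !mxE scaler_sumr -big_split; apply: eq_bigr => j _ /=.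
  by rewrite quotient_linear mulrDr mulrC -scalerAl mulrC.
under eq_bigr => j _ do
  rewrite quotient_linear mulrDr mulrC -scalerAl mulrC.
rewrite big_split /= -scaler_sumr scalerBr scalerDr opprD.
rewrite !addrA; congr (_ - _); rewrite -!addrA; congr (_ + _).
by rewrite addrCA [RHS]addrCA [- _ + _]addrC !addrA.
Qed.

Lemma recomposeB p q : recompose (p - q) = recompose p - recompose q.
Proof.
by rewrite -[p - q]addrC -scaleN1r recompose_linear scaleN1r addrC.
Qed.

Lemma recomposeD p q : recompose (p + q) = recompose p + recompose q.
Proof. by rewrite -{1}[p]scale1r recompose_linear scale1r. Qed.

Lemma recompose0 : recompose 0 = 0.
Proof. by have := recomposeB 0 0; rewrite !subrr. Qed.

Lemma quotient_lowSX N z j : vanish (lowSX (N + mdeg (L j))) z ->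
  vanish (lowSX N) (quotient z j).
Proof.
move=> hz a b ab; rewrite /quotient /=; case: ifP => // _.
rewrite fpsZE hz ?mulr0 // /lowSX mdegD addnA; move: ab; rewrite /lowSX; lia.
Qed.

Lemma irred_part_vanish (S : 'X_{1..m} -> 'X_{1..n} -> Prop) z :
  vanish S z -> vanish S (irred_part z).
Proof. by move=> hz a b ab; rewrite /=; case: ifP => // _; apply: hz. Qed.

Lemma recompose_lowSX : exists C, forall N z,
  vanish (lowSX (N + C)) z -> vanish (lowSX N) (recompose z).
Proof.
have [C hC] := sDact_lowSX D.
(* [C] pays for the derivations in D, [C'] for the division by leading monomials. *)
pose C' := (\sum_j mdeg (L j))%N; exists (C + C')%N => N z hz.
have hq j : vanish (lowSX (N + C)) (quotient z j).
  apply: quotient_lowSX; apply: lowSX_le hz.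
  by rewrite addnA leq_add2l /C' (bigD1 j) //= leq_addr.
apply: vanishB; first apply: vanishD.
- by apply/irred_part_vanish/(lowSX_le _ hz)/leq_addr.
- apply: vanish_sum => j _; apply: vanishM; first exact: lowSX_closed.
  by apply: lowSX_le (hq j); apply: leq_addr.
apply: hC => i; rewrite mxE; apply: vanish_sum => j _.
by apply: vanishM => //; apply: lowSX_closed.
Qed.

Lemma recompose_triangular z a b :
  (forall a' b', block_lt lts ltx (a, b) (a', b') -> z b' a' = 0) ->
  recompose z b a = z b a.
Proof.
move=> hz; rewrite /recompose !(fpsDE, fpsNE).
rewrite (sDact_coef_eq0 _ b lts_ord) ?subr0; last first.
  move=> i; rewrite mxE; apply: vanish_sum => j _; apply: vanishM.
    move=> a1 b1 a2 b2 aa _ h.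
    by have [<-//|h'] := lem_ltm lts_ord aa; apply: (ltm_trans lts_ord) h h'.
  move=> a' b' aa; rewrite /quotient /=; case: ifP => // _.
  by rewrite fpsZE hz ?mulr0 // /block_lt /= aa.
have gq j : (xemb m (g 0 j) * quotient z j) b a =
    if first_div b j then z b a else 0.
  have [gj gmax] := gL j.
  have -> : g 0 j = lc j *: fpsX (L j) + (g 0 j - lc j *: fpsX (L j)).
    by rewrite addrC subrK.
  rewrite xembD mulrDl !fpsDE xemb_mon smonM.
  (* A tail exponent b1 < L j of g_j meets a quotient exponent b2, whose coefficient stems from z at
     b2 + L j. This lies above b1 + b2, where z vanishes. *)
  rewrite [X in _ + X]ksx_mul_eq0 ?addr0 => [|a1 a2 b1 b2 aE bE]; last first.
    rewrite xembE fpsZE fpsBE fpsZE fpsXE.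
    case: (b1 =P L j) => [->|b1L]; first by rewrite mulr1 subrr !mul0r.
    rewrite mulr0 subr0; have [->|/gmax[//|ltb]] := eqVneq (g 0 j b1) 0.
      by rewrite !mul0r.
    rewrite /quotient /=; case: ifP => _; last by rewrite mulr0.
    rewrite fpsZE hz ?mulr0 // aE bE /block_lt /=.
    have [->|->//] := lem_ltm lts_ord (lem_addl a1 a2).
    by rewrite eqxx (addmC b2) (ltmD2r ltx_ord) ?orbT.
  have -> : (0 <= a)%MM by apply/mnm_lepP => i; rewrite mnm0E.
  rewrite /= subm0; case: ifP => [Lb|Lb]; last by rewrite /first_div Lb.
  rewrite /quotient /= submK //; case: ifP => _; last by rewrite mulr0.
  by rewrite fpsZE mulrA mulfV // mul1r.
rewrite !fps_sumE (eq_bigr _ (fun j _ => gq j)) /=.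
case: (boolP (reducible b)) => [/first_div_exists[j bj]|bn].
  rewrite (bigD1 j) //= bj big1 ?add0r ?addr0 // => i ij.
  by case: ifP => // bi; rewrite (first_div_uniq bi bj) eqxx in ij.
rewrite big1 ?addr0 // => j _; case: ifP => // /andP[Lb _].
by case/existsP: bn; exists j.
Qed.

Lemma recompose_eq0 z : recompose z = 0 -> z = 0.
Proof. exact: (triangular_eq0 lts_ord ltx_ord (@recompose_triangular)). Qed.

Lemma recompose_inj : injective recompose.
Proof.
move=> p q pq; apply/eqP; rewrite -subr_eq0; apply/eqP/recompose_eq0.
by rewrite recomposeB pq subrr.
Qed.

Lemma recompose_surj p : exists z, recompose z = p.
Proof.
exact: (triangular_surj lts_ord ltx_ord recomposeB (@recompose_triangular)).
Qed.

Lemma recompose_inv_cont N : exists M, forall z,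
  vanish (lowSX M) (recompose z) -> vanish (lowSX N) z.
Proof.
exact: (triangular_inv_cont lts_ord ltx_ord recomposeB
  (@recompose_triangular) recompose_lowSX).
Qed.

End Division.
(** * Termination of the algorithm *)

Section Runs.
Context (K : fieldType) (m n r l : nat).
Context (degs : 'X_{1..m} -> rat) (lts : rel 'X_{1..m}).
Context (degx : 'X_{1..n} -> rat) (ltx : rel 'X_{1..n}).
Hypotheses (lts_ord : local_degree_ordering degs lts).
Hypotheses (ltx_ord : local_degree_ordering degx ltx).
Context (D : 'M[diffop K m n]_(m, r)).
Context (g : 'rV[{fps K[n]}]_l) (U : 'M[{fps K[n]}]_(r, l)).
Context (L : 'I_l -> 'X_{1..n}).
Hypothesis gL : forall j, is_xlead ltx (g 0 j) (L j).
Implicit Types (p q z t : Ksx K m n) (a : 'X_{1..m}) (b : 'X_{1..n}).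

Notation lc j := (g 0 j (L j)).
Notation Phi := (recompose D g U L).
Notation lead_g := (lead_g m ltx g).
Notation NFK := (NFK degs degx lts ltx D g U).
Notation q0 := (NF_q0 degs degx lts ltx D).
Notation quotient z j := (quotient g L z j).

Lemma irred_part_smon u a b :
  irred_part L (smon u a b : Ksx K m n) = if reducible L b then 0 else smon u a b.
Proof.
apply: ksxP => a' b'; rewrite irred_partE.
case: (b' =P b) => [->|/eqP/negPf b'b].
  by case: ifP.
have -> : (if reducible L b' then 0 else smon u a b b') a' = 0.
  by case: ifP => // _; rewrite smonE b'b andbF.
by case: ifP => // _; rewrite smonE b'b andbF.
Qed.

Lemma quotient_smon u a b j : quotient (smon u a b : Ksx K m n) j =
  if first_div L b j then smon ((lc j)^-1 * u) a (b - L j)%MM else 0.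
Proof.
apply: ksxP => a' b'.
rewrite quotientE.
case: (boolP (first_div L b j)) => [bj|bj].
  have /andP[Lb _] := bj; rewrite smonE.
  have -> : (b' == b - L j)%MM = (b' + L j == b)%MM.
    by apply/eqP/eqP => [->|<-]; rewrite ?submK ?addmK.
  case: ((b' + L j)%MM =P b) => [->|/eqP/negPf b'b].
    by rewrite bj fpsZE smonE eqxx andbT; case: ifP; rewrite ?mulr0.
  rewrite andbF; case: ifP => // _; rewrite fpsZE smonE.
  by rewrite b'b andbF mulr0.
case: ifP => // b'j; rewrite fpsZE smonE; case: ifP => [/andP[_ /eqP e]|_].
  by rewrite -e b'j in bj.
by rewrite mulr0.
Qed.

Lemma recompose_irred u a b : ~~ reducible L b -> Phi (smon u a b) = smon u a b.
Proof.
move=> bn; have nd j : first_div L b j = false.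
  by apply: contraNF bn => /andP[Lb _]; apply/existsP; exists j.
have q_eq0 j : quotient (smon u a b : Ksx K m n) j = 0 by rewrite quotient_smon nd.
rewrite /recompose irred_part_smon (negPf bn) big1 => [|j _]; last first.
  by rewrite q_eq0 mulr0.
rewrite addr0 sDact_eq0 ?subr0 // => i; rewrite mxE big1 // => j _.
by rewrite q_eq0 mulr0.
Qed.

(** The right-hand side is what a reduction step of the algorithm subtracts. *)
Lemma recompose_first_div u a b j (c := smon ((lc j)^-1 * u) a (b - L j)%MM) :
  first_div L b j -> Phi (smon u a b) =
  c * xemb m (g 0 j) - sDact D (c *: map_mx (xemb m) (col j U)).
Proof.
move=> bj; have qE i : quotient (smon u a b : Ksx K m n) i = if i == j then c else 0.
  rewrite quotient_smon; case: eqP => [->|ij]; first by rewrite bj.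
  by case: ifP => // bi; case: ij; apply: first_div_uniq bi bj.
have br : reducible L b by case/andP: bj => Lb _; apply/existsP; exists j.
rewrite /recompose irred_part_smon br add0r; congr (_ - sDact D _).
  rewrite (bigD1 j) //= big1 ?addr0 => [|i /negPf ij]; rewrite qE.
    by rewrite eqxx mulrC.
  by rewrite ij mulr0.
apply/matrixP => i i'; rewrite ord1 !mxE (bigD1 j) //= big1 => [|k /negPf kj].
  by rewrite qE eqxx addr0 mulrC.
by rewrite qE kj mulr0.
Qed.

Lemma lead_gE j : lead_g j = smon (lc j) 0%MM (L j).
Proof. by rewrite /Defs.lead_g (xleadE ltx_ord (gL j)) xemb_mon. Qed.

Lemma smon_div u a b j : (L j <= b)%MM ->
  smon u a b = smon ((lc j)^-1 * u) a (b - L j)%MM * lead_g j.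
Proof.
move=> Lb; rewrite lead_gE smon_mul addm0 submK // mulrAC mulVf ?mul1r //.
by case: (gL j).
Qed.

(** The index set A is arbitrary to cover both the ideal <lead(g)> and, for a singleton, the
    minimality test on j. *)
Lemma lead_g_span (A : set 'I_l) u a b : u != 0 ->
  ideal_span (lead_g @` A) (smon u a b) <-> exists2 j, A j & (L j <= b)%MM.
Proof.
move=> u0; split=> [h|[j Aj Lb]]; last first.
  by rewrite (smon_div u a Lb); apply/ideal_spanM/ideal_span_gen; exists j.
apply: contrapT => hn; case/eqP: u0.
have -> : u = smon u a b b a by rewrite smonE !eqxx.
rewrite (monomial_span_coef (b := b) h) // => _ [j Aj <-].
exists (lc j *: fpsX 0%MM), (L j); rewrite lead_gE; split=> //.
by apply/negP => Lb; apply: hn; exists j.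
Qed.

Lemma lead_g_range u a b : u != 0 ->
  ideal_span (range lead_g) (smon u a b) <-> reducible L b.
Proof.
move=> u0; split=> [/(lead_g_span _ _ _ u0)[j _ Lb]|/existsP[j Lb]].
  by apply/existsP; exists j.
by apply/(lead_g_span _ _ _ u0); exists j.
Qed.

(** The algorithm specifies c only by an equation; multiplication by a monomial term is injective,
    so c is the expected term. *)
Lemma smon_div_uniq u a b j c : u != 0 -> smon u a b = c * lead_g j ->
  (L j <= b)%MM /\ c = smon ((lc j)^-1 * u) a (b - L j)%MM.
Proof.
move=> u0 e; have [lj _] := gL j.
have coefE a' b' : smon u a b (b' + L j)%MM a' = c b' a' * lc j.
  rewrite e lead_gE mulrC smonM lem_addl addmK subm0 mulrC.
  by have -> : (0 <= a')%MM by apply/mnm_lepP => i; rewrite mnm0E.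
have Lb : (L j <= b)%MM.
  apply: contraT => Lb; case/eqP: u0.
  have -> : u = smon u a b b a by rewrite smonE !eqxx.
  by rewrite e lead_gE mulrC smonM (negPf Lb) andbF.
split=> //; apply: ksxP => a' b'; apply: (mulIf lj); rewrite -coefE !smonE.
have -> : (b' == b - L j)%MM = (b' + L j == b)%MM.
  by apply/eqP/eqP => [->|<-]; rewrite ?submK ?addmK.
by case: ifP; rewrite ?mul0r // mulrAC mulVf ?mul1r.
Qed.

(** The witness z is the sum of the leading terms treated in the run: each goes to the remainder or,
    divided by lead(g_j), to one quotient, and its image under [Phi] is what the step subtracts. *)
Lemma NFK_recompose k p t (A : 'rV_l) q : NFK k p t A q ->
  exists z, [/\ t = irred_part L z, forall j, A 0 j = quotient z j
              & p = Phi z + q].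
Proof.
elim=> {p t A q} [p p0|p j c t A q r0 r0n _ jmin cE _ [z [-> Az pE]]
                 |p t A q r0 r0n lead_irr _ [z [-> Az pE]]].
- exists 0; split=> [|j|].
  + by apply: ksxP => a b /=; case: ifP.
  + by apply: ksxP => a b; rewrite mxE /=; case: ifP => // _; rewrite scaler0.
  + by rewrite recompose0 add0r; apply/eqP; rewrite -subr_eq0 p0.
- have [a [b r0ab]] := lead_exists lts_ord ltx_ord r0n; have [u0 _] := r0ab.
  rewrite (leadE lts_ord ltx_ord r0ab) in jmin cE; set u := r0 b a in u0 jmin cE.
  have [Lb cE'] := smon_div_uniq u0 cE.
  have bj : first_div L b j.
    rewrite /first_div Lb; apply/forallP => i; apply/implyP => ij.
    apply/negP => Li; apply: (jmin i ij).
    by rewrite -image_set1; apply/(lead_g_span _ _ _ u0); exists i.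
  exists (z + smon u a b); split=> [|i|].
  + by rewrite irred_partD irred_part_smon ifT ?addr0 //; apply/existsP; exists j.
  + rewrite quotientD !mxE Az eqxx quotient_smon /=.
    congr (_ + _); case: (i =P j) => [->|ij]; first by rewrite bj mulr1.
    by case: ifP => [bi|_]; [case: ij; apply: first_div_uniq bi bj|rewrite mulr0].
  + rewrite recomposeD (recompose_first_div _ _ bj) -cE'.
    move: (Phi z) pE; set S := sDact _ _; set T := c * _ => W pE.
    rewrite -[LHS](subrK (q0 k p)) -/r0.
    have -> : r0 = W + q + T - S by rewrite -pE addrAC addrK subrK.
    rewrite [q0 k p + q]addrC [RHS]addrA; congr (_ + _).
    by rewrite -!addrA; congr (_ + _); rewrite addrC -addrA.
- have [a [b r0ab]] := lead_exists lts_ord ltx_ord r0n; have [u0 _] := r0ab.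
  rewrite (leadE lts_ord ltx_ord r0ab) in lead_irr pE *.
  set u := r0 b a in u0 lead_irr pE *.
  have bn : ~~ reducible L b by apply/negP => /(lead_g_range a b u0).
  exists (z + smon u a b); split=> [|i|].
  + by rewrite irred_partD irred_part_smon (negPf bn) addrC.
  + rewrite quotientD Az quotient_smon ifF ?addr0 //.
    by apply: contraNF bn => /andP[Li _]; apply/existsP; exists i.
  + rewrite recomposeD recompose_irred //.
    move: (Phi z) pE => W pE.
    rewrite -[LHS](subrK (q0 k p)) -/r0.
    have -> : r0 = W + q + smon u a b by rewrite -pE subrK.
    by rewrite [q0 k p + q]addrC [RHS]addrA; congr (_ + _); rewrite addrAC.
Qed.

Lemma small_termsD k p q : small_terms degs degx D k p ->
  small_terms degs degx D k q -> small_terms degs degx D k (p + q).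
Proof.
move=> hp hq a b; have [p0|/hp //] := eqVneq (p b a) 0.
by rewrite ksxDE p0 add0r => /hq.
Qed.

Lemma NFK_small k p t (A : 'rV_l) q : NFK k p t A q ->
  small_terms degs degx D k q.
Proof.
elim=> {p t A q} [p _|p j c t A q r0 _ _ _ _ _ IH|p t A q r0 _ _ _ IH].
- exact: NF_q0_small.
- by apply: small_termsD IH; apply: NF_q0_small.
- by apply: small_termsD IH; apply: NF_q0_small.
Qed.

Definition NFK_halts k p := exists t A q, NFK k p t A q.

(* Both kinds of step replace r0 by r0 - Phi (lead r0). *)
Lemma NFK_step k p (r0 := p - q0 k p) a b : is_lead lts ltx r0 a b ->
  exists2 p', NFK_halts k p' -> NFK_halts k p
  & forall a' b', p' b' a' != 0 -> block_lt lts ltx (a', b') (a, b).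
Proof.
move=> r0ab; have [u0 abmax] := r0ab.
have r0n : r0 != 0.
  by apply: contraNneq u0 => ->.
have leadr0 := leadE lts_ord ltx_ord r0ab; set u := r0 b a in u0 leadr0.
exists (r0 - Phi (smon u a b)) => [|a' b']; last first.
  apply: contraNT => hn.
  have tri : Phi (smon u a b) b' a' = smon u a b b' a'.
    apply: (recompose_triangular lts_ord ltx_ord) => // a1 b1 h.
    rewrite smonE; case: ifP => // /andP[/eqP a1a /eqP b1b].
    by rewrite -a1a -b1b h in hn.
  rewrite ksxBE tri subr_eq0 smonE; case: ifP => [/andP[/eqP-> /eqP->] //|ne].
  apply: contraNT hn => /abmax[[a'a b'b]|//].
  by rewrite a'a b'b !eqxx in ne.
case: (boolP (reducible L b)) => [br|bn] [t [A [q]]].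
  have [j bj] := first_div_exists br.
  have /andP[Lb /forallP jmin] := bj.
  rewrite (recompose_first_div _ _ bj); set c := smon _ _ _ => h.
  exists t, (A + c *: delta_mx 0 j), (q0 k p + q).
  apply: NFK_reduce => //.
  - by rewrite -/r0 leadr0; apply/lead_g_range.
  - move=> i ij; rewrite -/r0 leadr0 -image_set1 => /(lead_g_span _ _ _ u0)[_ -> Li].
    by have := jmin i; rewrite ij Li.
  - by rewrite -/r0 leadr0 -smon_div.
  - by rewrite -/r0; move: h; rewrite opprB addrA addrAC.
rewrite recompose_irred // => h.
exists (lead lts ltx r0 + t), A, (q0 k p + q); apply: NFK_keep => //.
  by rewrite -/r0 leadr0 => /(lead_g_range a b u0); apply/negP.
by rewrite -/r0 leadr0.
Qed.

(* While q0 = 0 the leading s-exponent a cannot increase and, for fixed a, the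
   leading x-exponent decreases among the finitely many with
   deg >= NK k - deg a; otherwise a drops, among the finitely many exponents
   not below some exponent of total degree < |k|. *)
Lemma NFK_total k p : NFK_halts k p.
Proof.
have stop q : q - q0 k q = 0 -> NFK_halts k q.
  by move=> h; exists 0, 0, (q0 k q); apply: NFK_stop.
have stop_low q : vanish (lowS (absz k)) q -> NFK_halts k q.
  by move=> h; apply: stop; rewrite NF_q0_stop // subrr.
have [->|p0] := eqVneq p 0; first exact: stop_low.
have [a [b pab]] := lead_exists lts_ord ltx_ord p0.
(* Once the leading s-exponent has degree below d, no term has total s-degree below |k|, so the
   series lies in <s>^|k| and the run stops. *)
have [d dP] := deg_bounded degs (absz k).
elim/(well_founded_ind (wf_ltm_down lts_ord d)): a p b {p0} pab => a IHa.
have halts_below q : (forall a' b', q b' a' != 0 -> lts a' a) -> NFK_halts k q.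
  move=> qa; have [/stop_low//|qlow] := pselect (vanish (lowS (absz k)) q).
  have [q0E|q0n] := eqVneq q 0; first by case: qlow; rewrite q0E.
  have [a1 [b1 qab]] := lead_exists lts_ord ltx_ord q0n.
  apply: (IHa a1 _ q b1 qab); rewrite (qa a1 b1) /=; last by case: qab.
  apply: contrapT => /negP; rewrite -ltNge => ad; apply: qlow => a2 b2 a2k.
  apply/eqP; apply: contraPT (dP _ a2k) => /(qab.2 a2 b2)[[-> _]|].
    by apply/negP; rewrite -ltNge.
  rewrite /block_lt /= => /orP[/(ltm_deg lts_ord) h|/andP[/eqP -> _]].
    by apply/negP; rewrite -ltNge; apply: le_lt_trans ad.
  by apply/negP; rewrite -ltNge.
have halts_step q (r0 := q - q0 k q) :
    (forall a' b', r0 b' a' != 0 -> lts a' a) -> NFK_halts k q.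
  move=> r0a; have [/stop//|r0n] := eqVneq r0 0.
  have [a1 [b1 r0ab]] := lead_exists lts_ord ltx_ord r0n.
  have [q' q'q q'a] := NFK_step r0ab; apply/q'q/halts_below => a' b' /q'a.
  have a1a : lts a1 a by apply: r0a (r0ab.1).
  rewrite /block_lt /= => /orP[h|/andP[/eqP -> _]] //.
  exact: (ltm_trans lts_ord) h a1a.
have halts_slead q b : is_lead lts ltx q a b -> q0 k q = slead lts q ->
    NFK_halts k q.
  move=> qab qs; apply: halts_step => a' b'; rewrite qs ksxBE (sleadE lts_ord qab).
  case: (a' =P a) => [->|a'a]; first by rewrite subrr eqxx.
  rewrite subr0 => /(qab.2)[[]//|].
  by rewrite /block_lt /= => /orP[//|/andP[/eqP]].
move=> p b; pose e := NK degs degx D k - degs a.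
elim/(well_founded_ind (wf_ltm_down ltx_ord e)): b p => b IHb p pab.
have [/stop_low//|plow] := pselect (vanish (lowS (absz k)) p).
have [ps|p0] := NF_q0_cases degs degx D pab plow; first exact: (halts_slead p b).
have r0ab : is_lead lts ltx (p - q0 k p) a b by rewrite p0 subr0.
have [p' p'p p'a] := NFK_step r0ab; apply: p'p.
have [/stop_low//|p'low] := pselect (vanish (lowS (absz k)) p').
have [p'0|p'n] := eqVneq p' 0; first by case: p'low; rewrite p'0.
have [a1 [b1 p'ab]] := lead_exists lts_ord ltx_ord p'n.
have := p'a _ _ p'ab.1; rewrite {1}/block_lt /= => /orP[a1a|].
  apply: halts_below => a' b' /(p'ab.2)[[-> _]//|].
  rewrite /block_lt /= => /orP[h|/andP[/eqP -> _]] //.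
  exact: (ltm_trans lts_ord) h a1a.
move=> /andP[/eqP a1a b1b]; rewrite {}a1a in p'ab.
have [h|h] := leP e (degx b1).
  by apply: IHb p'ab; rewrite b1b h.
(* The leading degree is now below N_K, so q_0 removes the whole coefficient of s^a. *)
apply: (halts_slead _ _ p'ab); apply: (NF_q0_lt lts_ord ltx_ord p'ab p'low).
by rewrite addrC -ltrBrDr.
Qed.

End Runs.
(** * Convergence of the normal form *)

Section Limits.
Context (K : fieldType) (m n r l : nat).
Context (degs : 'X_{1..m} -> rat) (lts : rel 'X_{1..m}).
Context (degx : 'X_{1..n} -> rat) (ltx : rel 'X_{1..n}).
Hypotheses (lts_ord : local_degree_ordering degs lts).
Hypotheses (ltx_ord : local_degree_ordering degx ltx).
Context (D : 'M[diffop K m n]_(m, r)).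
Context (g : 'rV[{fps K[n]}]_l) (U : 'M[{fps K[n]}]_(r, l)).
Context (L : 'I_l -> 'X_{1..n}).
Hypothesis gL : forall j, is_xlead ltx (g 0 j) (L j).
Context (k : nat -> int).
Hypothesis NK_incr : forall a b : int, a <= 0 -> b <= 0 -> a < b ->
  NK degs degx D a < NK degs degx D b.
Hypothesis k_le0 : forall i, k i <= 0.
Hypothesis k_decr : forall i, k i.+1 < k i.
Implicit Types (p q z t v : Ksx K m n) (u : nat -> Ksx K m n).

Notation Phi := (recompose D g U L).
Notation NFK := (NFK degs degx lts ltx D g U).

Lemma adic_sum_uniq u v v' : adic_sum u v -> adic_sum u v' -> v = v'.
Proof.
move=> hv hv'; apply/eqP; rewrite -subr_eq0; apply/eqP/ksxP => a b.
have [M hM] := hv (mdeg a + mdeg b).+1; have [M' hM'] := hv' (mdeg a + mdeg b).+1.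
have h := hM _ (leq_maxl M M'); have h' := hM' _ (leq_maxr M M').
have := vanishB ((sxideal_expP _ _).1 h) ((sxideal_expP _ _).1 h').
by rewrite opprB addrA subrK; apply; rewrite /lowSX.
Qed.

Lemma k_le i : k i <= - i%:Z.
Proof.
elim: i => [|i IHi]; first by rewrite oppr0.
have := k_decr i; lia.
Qed.

(** Terms of total degree below M have degree at least ds + dx, whereas |k i| tends to infinity and
    [NK (k i)] to minus infinity; for large i neither alternative of [small_terms] is left. *)
Lemma small_terms_vanish M : exists I, forall i p, (I <= i)%N ->
  small_terms degs degx D (k i) p -> vanish (lowSX M) p.
Proof.
have [ds hs] := deg_bounded degs M; have [dx hx] := deg_bounded degx M.
(* Comparing N_{-1} with N_0 gives the sign. It excludes m = 0, where [mins] has the default value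
   0. *)
have s0 : mins degs < 0.
  by have := @NK_incr (-1) 0 isT isT isT; rewrite /NK; lra.
set C := - minx degx + maxD degs degx D.
(* From K = -B on, N_K = C - K mins stays below ds + dx. *)
pose B := Num.bound `|(C - (ds + dx)) / - mins degs|.
have BP : C - (ds + dx) < B%:R * - mins degs.
  rewrite -ltr_pdivrMr ?oppr_gt0 //.
  exact: le_lt_trans (ler_norm _) (archi_boundP (normr_ge0 _)).
exists (maxn M B) => i p iI hp a b; rewrite /lowSX => ab.
apply/eqP; apply: contraT => /hp[|h].
  have := k_le i; move: ab iI; lia.
have ha : ds <= degs a by apply: hs; move: ab; lia.
have hb : dx <= degx b by apply: hx; move: ab; lia.
have kB : B%:R <= - (k i)%:~R :> rat.
  by rewrite -mulrNz pmulrn ler_int; have := k_le i; move: iI; lia.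
have : B%:R * - mins degs <= - (k i)%:~R * - mins degs.
  by rewrite ler_wpM2r // oppr_ge0 ltW.
move: h; rewrite /NK -addrA -/C !mulrN; lra.
Qed.

Lemma run_converges ps ts (As : nat -> 'rV_l) z :
  ps 0%N = Phi z -> (forall i, NFK (k i) (ps i) (ts i) (As i) (ps i.+1)) ->
  adic_sum ts (irred_part L z) /\
  forall j, adic_sum (fun i => As i 0 j) (quotient g L z j).
Proof.
move=> ps0 run.
have [zs zsP] : {zs : nat -> Ksx K m n & forall i, [/\ ts i = irred_part L (zs i),
    forall j, As i 0 j = quotient g L (zs i) j & ps i = Phi (zs i) + ps i.+1]}.
  apply: (@boolp.choice _ _ (fun i y => [/\ ts i = irred_part L y,
    forall j, As i 0 j = quotient g L y j & ps i = Phi y + ps i.+1])) => i.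
  exact: (NFK_recompose lts_ord ltx_ord gL (run i)).
(* Telescoping: the error p_N is the image of the tail of z, so small errors force small tails. *)
have psE N : Phi (z - \sum_(i < N) zs i) = ps N.
  elim: N => [|N IHN]; first by rewrite big_ord0 subr0.
  rewrite big_ord_recr opprD addrA recomposeB IHN.
  by have [_ _ ->] := zsP N; rewrite addrC addKr.
have irred_sum N : irred_part L (z - \sum_(i < N) zs i) =
    irred_part L z - \sum_(i < N) ts i.
  elim: N => [|N IHN]; first by rewrite !big_ord0 !subr0.
  rewrite !big_ord_recr !opprD !addrA -IHN; have [-> _ _] := zsP N.
  exact: irred_partB.
have quotient_sum j N : quotient g L (z - \sum_(i < N) zs i) j =
    quotient g L z j - \sum_(i < N) As i 0 j.
  elim: N => [|N IHN]; first by rewrite !big_ord0 !subr0.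
  rewrite !big_ord_recr !opprD !addrA -IHN; have [_ -> _] := zsP N.
  exact: quotientB.
have tail N : exists I, forall i, (I <= i)%N ->
    vanish (lowSX N) (z - \sum_(j < i) zs j).
  have [M hM] := recompose_inv_cont lts_ord ltx_ord D U gL N.
  have [I hI] := small_terms_vanish M.
  (* The shift is due to p_0, which is arbitrary; only later p_i are outputs of a run. *)
  exists I.+1 => -[//|i] Ii; apply: hM; rewrite psE; apply: (hI i) => //.
  exact: (NFK_small lts_ord ltx_ord (run i)).
split=> [|j] N.
  have [I hI] := tail N; exists I => i /hI zi.
  by apply/sxideal_expP; rewrite -irred_sum; apply: irred_part_vanish.
have [I hI] := tail (N + mdeg (L j))%N; exists I => i /hI zi.
by apply/sxideal_expP; rewrite -quotient_sum; apply: quotient_lowSX.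
Qed.

Lemma run_exists p : exists ps ts (As : nat -> 'rV_l), ps 0%N = p /\
  forall i, NFK (k i) (ps i) (ts i) (As i) (ps i.+1).
Proof.
have [next nextP] : {next : nat * Ksx K m n -> Ksx K m n * 'rV_l * Ksx K m n &
    forall x, NFK (k x.1) x.2 (next x).1.1 (next x).1.2 (next x).2}.
  apply: (@boolp.choice _ _ (fun x y => NFK (k x.1) x.2 y.1.1 y.1.2 y.2)) => -[i q].
  have [t [A [q' h]]] := NFK_total lts_ord ltx_ord D U gL (k i) q.
  by exists (t, A, q').
pose ps := fix ps i := if i is j.+1 then (next (j, ps j)).2 else p.
exists ps, (fun i => (next (i, ps i)).1.1), (fun i => (next (i, ps i)).1.2).
by split=> // i; apply: (nextP (i, ps i)).
Qed.

(** Makes the relation [is_NF] the graph of a function: one direction uses uniqueness of adic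
    limits, the other the existence of runs, hence termination. *)
Lemma is_NF_recompose z t (A : 'rV_l) :
  is_NF degs degx lts ltx D g U k (Phi z) t A <->
  t = irred_part L z /\ A = \row_j quotient g L z j.
Proof.
split=> [[ps [ts [As [ps0 run tsum Asum]]]]|[-> ->]].
  have [ht hA] := run_converges ps0 run.
  split; first exact: adic_sum_uniq tsum ht.
  by apply/rowP => j; rewrite mxE; apply: adic_sum_uniq (Asum j) (hA j).
have [ps [ts [As [ps0 run]]]] := run_exists (Phi z).
have [ht hA] := run_converges ps0 run.
by exists ps, ts, As; split=> // j; rewrite mxE.
Qed.

End Limits.
(** * The quotient H *)

Section FreeModule.
Context (K : fieldType) (m : nat).
Local Notation A := {fps K[m]}.
Context (M : lmodType A) (mu : nat) (h : 'I_mu -> M).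
Notation phi c := (\sum_i c i *: h i).

(* The splitting of phi given by a basis of M turns a kernel vector c into
   c = sum_i c_i d_i where each d_i lies in the kernel, hence has entries in
   the maximal ideal; so c lies in every power of it. *)
Lemma free_ker_trivial : free_lmodule M ->
  (forall x, exists c : 'I_mu -> A, x = phi c) ->
  (forall c : 'I_mu -> A, phi c = 0 -> forall i, c i 0%MM = 0) ->
  forall c : 'I_mu -> A, phi c = 0 -> forall i, c i = 0.
Proof.
move=> [I [e e_basis]] phi_surj ker_max.
have [coord coordP] : {coord : M -> {fsfun I -> A with 0} &
    forall x, x = \sum_(i <- finsupp (coord x)) coord x i *: e i}.
  apply: (@boolp.choice _ _ (fun x c => x = \sum_(i <- finsupp c) c i *: e i)) => x.
  by have [c []] := e_basis x; exists c.
have coord_uniq x c : x = \sum_(i <- finsupp c) c i *: e i -> coord x = c.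
  move=> xc; have [c' [_ c'u]] := e_basis x.
  by rewrite -(c'u _ xc) -(c'u _ (coordP x)).
have [v vP] : {v : I -> 'I_mu -> A & forall j, e j = phi (v j)}.
  exact: (@boolp.choice _ _ (fun j c => e j = phi c)).
have sum_supp (V : zmodType) (c : {fsfun I -> A with 0}) (E : {fset I})
    (G : A -> I -> V) : (forall j, G 0 j = 0) -> (finsupp c `<=` E)%fset ->
    \sum_(j <- finsupp c) G (c j) j = \sum_(j <- E) G (c j) j.
  move=> G0 cE; apply: big_fset_incl => // j _ jc.
  by rewrite fsfun_dflt.
pose psi x (i : 'I_mu) : A := \sum_(j <- finsupp (coord x)) coord x j * v j i.
have phi_psi x : phi (psi x) = x.
  rewrite [RHS]coordP; under eq_bigr => i _ do rewrite scaler_suml.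
  rewrite exchange_big; apply: eq_bigr => j _.
  by rewrite vP scaler_sumr; apply: eq_bigr => i _; rewrite scalerA.
have psi_linear u x y i : psi (u *: x + y) i = u * psi x i + psi y i.
  pose E := (finsupp (coord x) `|` finsupp (coord y))%fset.
  pose c := [fsfun j in E => u * coord x j + coord y j : A | 0].
  have cE j : c j = u * coord x j + coord y j.
    rewrite fsfunE; case: ifP => // /negbT; rewrite inE negb_or => /andP[xj yj].
    by rewrite !fsfun_dflt // mulr0 addr0.
  have cs : (finsupp c `<=` E)%fset by apply: finsupp_sub.
  have xs : (finsupp (coord x) `<=` E)%fset by apply: fsubsetUl.
  have ys : (finsupp (coord y) `<=` E)%fset by apply: fsubsetUr.
  have cuxy : coord (u *: x + y) = c.
    apply: coord_uniq.
    have G0 j : 0 *: e j = 0 := scale0r (e j).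
    rewrite (sum_supp M c E (fun a j => a *: e j)) //.
    under eq_bigr => j _ do rewrite cE scalerDl -scalerA.
    rewrite big_split /= -scaler_sumr.
    rewrite -(sum_supp M _ E (fun a j => a *: e j) G0 xs).
    rewrite -(sum_supp M _ E (fun a j => a *: e j) G0 ys).
    by rewrite -!coordP.
  have G0 j : 0 * v j i = 0 := mul0r (v j i).
  rewrite /psi cuxy (sum_supp A c E (fun a j => a * v j i)) //.
  under eq_bigr => j _ do rewrite cE mulrDl -mulrA.
  rewrite big_split /= -mulr_sumr.
  rewrite -(sum_supp A _ E (fun a j => a * v j i) G0 xs).
  by rewrite -(sum_supp A _ E (fun a j => a * v j i) G0 ys).
have psi0 i : psi 0 i = 0.
  by have := psi_linear (-1) 0 0 i; rewrite scaler0 addr0 mulN1r addNr.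
have psi_phi c i : psi (phi c) i = \sum_j c j * psi (h j) i.
  elim/big_rec2: _ => [|j x y _ <-]; first exact: psi0.
  by rewrite psi_linear.
move=> c c0.
(* Row i of 1 - psi phi, the projection of A^mu onto the kernel of phi. *)
pose d i j : A := (i == j)%:R - psi (h i) j.
have d0 i j : d i j 0%MM = 0.
  apply: (ker_max (d i)); under eq_bigr => i' _ do rewrite scalerBl.
  rewrite sumrB phi_psi (bigD1 i) //= eqxx scale1r big1 ?addr0 ?subrr // => i'.
  by rewrite eq_sym => /negPf ->; rewrite scale0r.
have cd i : c i = \sum_j c j * d j i.
  under eq_bigr => j _ do rewrite mulrBr.
  rewrite sumrB -psi_phi c0 psi0 subr0 (bigD1 i) //= eqxx mulr1 big1 ?addr0 //.
  by move=> j /negPf ->; rewrite mulr0.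
suff low N i a : (mdeg a < N)%N -> c i a = 0.
  by move=> i; apply: fpsP => a; apply: (low (mdeg a).+1).
elim: N i a => // N IHN i a aN; rewrite cd fps_sumE big1 // => j _.
apply: fps_mul_eq0 => k1 k2 ak; have [->|k20] := eqVneq k2 0%MM.
  by rewrite d0 mulr0.
rewrite IHN ?mul0r //; move: aN k20; rewrite ak mdegD -mdeg_eq0; lia.
Qed.

End FreeModule.

(** * The presentation of H by the standard monomials *)

Section Presentation.
Context (K : fieldType) (m n r l mu : nat).
Context (degx : 'X_{1..n} -> rat) (ltx : rel 'X_{1..n}).
Hypothesis ltx_ord : local_degree_ordering degx ltx.
Context (f : 'rV[{fps K[n]}]_r) (D : 'M[diffop K m n]_(m, r)).
Context (g : 'rV[{fps K[n]}]_l) (U : 'M[{fps K[n]}]_(r, l)).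
Context (L : 'I_l -> 'X_{1..n}).
Hypothesis gL : forall j, is_xlead ltx (g 0 j) (L j).
Context (mon : 'I_mu -> 'X_{1..n}).
Implicit Types (p q z : Ksx K m n) (a : 'X_{1..m}) (b : 'X_{1..n}).

Notation F := (Fop f D).

Lemma recompose_imF z : g = f *m U ->
  recompose D g U L z - irred_part L z \in imF F.
Proof.
move=> gU; apply/asboolP; exists (fun i => lift_quotient g U L z i 0).
rewrite Fop_act /recompose addrAC [irred_part _ _ + _]addrC addrK.
congr (_ - _); under [RHS]eq_bigr => i _ do rewrite mxE mulr_sumr.
rewrite exchange_big; apply: eq_bigr => j _ /=.
rewrite {1}gU mxE xemb_sum mulr_suml; apply: eq_bigr => i _.
by rewrite xemb_mul mulrA.
Qed.

(** At s = 0 the operator F_i is multiplication by f_i, as sD only produces multiples of the s_j. *)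
Lemma imF_scoef0 p : p \in imF F -> ideal_span (range (f 0)) (scoef p 0%MM).
Proof.
move=> /asboolP[q pE].
have -> : scoef p 0%MM = \sum_i f 0 i * scoef (q i) 0%MM.
  apply: fpsP => b; rewrite scoefE pE.
  have -> : \sum_i dact (F 0 i) (q i) =
      \sum_i dact (F 0 i) ((\col_i q i : 'cV_r) i 0).
    by apply: eq_bigr => i _; rewrite mxE.
  rewrite Fop_act ksxBE !fps_sumE [X in _ - X]big1 ?subr0 => [|j _]; last first.
    rewrite svarE smonM; case: ifP => // /andP[/mnm_lepP/(_ j)].
    by rewrite mnm1E mnm0E eqxx.
  apply: eq_bigr => i _; rewrite mxE !fpsME fps_sumE; apply: eq_bigr => k _.
  by rewrite xembE -scalerAl mul1r fpsZE.
apply: ideal_span_sum => i; rewrite mulrC.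
by apply/ideal_spanM/ideal_span_gen; exists i.
Qed.

Lemma xlead_span_reducible (h : {fps K[n]}) b :
  ideal_span (range (fun i => xlead ltx (g 0 i))) h -> h b != 0 -> reducible L b.
Proof.
move=> hI hb; apply: contraT => bn; case/eqP: hb.
apply: monomial_span_coef hI _ => _ [j _ <-].
exists (g 0 j (L j)), (L j); split; first exact: (xleadE ltx_ord (gL j)).
by apply: contraNN bn => Lb; apply/existsP; exists j.
Qed.

Lemma reducibleE b : reducible L b <->
  ideal_span (range (fun i => xlead ltx (g 0 i))) (fpsX b).
Proof.
split=> [/existsP[j Lb]|h]; last first.
  by apply: xlead_span_reducible h _; rewrite fpsXE eqxx oner_eq0.
have [lj _] := gL j.
have -> : fpsX b = ((g 0 j (L j))^-1 *: fpsX (b - L j)%MM) * xlead ltx (g 0 j)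
    :> {fps K[n]}.
  rewrite (xleadE ltx_ord (gL j)) -scalerAl mulrC -scalerAl -fpsXD addmC submK //.
  by rewrite scalerA mulVf ?scale1r.
by apply/ideal_spanM/ideal_span_gen; exists j.
Qed.

(** The standard basis property: a nonzero element of <f> would have a reducible leading
    monomial. *)
Lemma irreducible_ideal_eq0 (h : {fps K[n]}) : standard_basis ltx f g ->
  ideal_span (range (f 0)) h -> (forall b, h b != 0 -> ~~ reducible L b) -> h = 0.
Proof.
move=> [_ spanE] hI hb; have [//|h0] := eqVneq h 0.
have [b hlead] := xlead_exists ltx_ord h0; have [hb0 _] := hlead.
case/negP: (hb _ hb0); apply: (@xlead_span_reducible (xlead ltx h)).
  by rewrite -spanE; apply: ideal_span_gen; exists h.
by rewrite (xleadE ltx_ord hlead) fpsZE fpsXE eqxx mulr1.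
Qed.

Hypothesis mon_std : standard_monomials ltx g mon.

Lemma mon_irreducible b : (exists i, mon i = b) <-> ~~ reducible L b.
Proof.
rewrite (mon_std.1 b); split=> [h|/negP h /reducibleE //].
by apply/negP => /reducibleE.
Qed.

Lemma mon_inj : injective mon.
Proof.
move=> i j ij; apply: val_inj; have [_ mono] := mon_std.
by case: (ltngtP i j) => // /mono; rewrite ij (ltmm ltx_ord).
Qed.

Lemma mon_sum_coef (R : comNzRingType) (c : 'I_mu -> R) i :
  (\sum_j c j *: fpsX (mon j) : {fps R[n]}) (mon i) = c i.
Proof.
rewrite fps_sumE (bigD1 i) //= eqxx mulr1 big1 ?addr0 // => j ji.
by rewrite (inj_eq mon_inj) eq_sym (negPf ji) mulr0.
Qed.

Lemma mon_sum_reducible (R : comNzRingType) (c : 'I_mu -> R) b :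
  reducible L b -> (\sum_j c j *: fpsX (mon j) : {fps R[n]}) b = 0.
Proof.
move=> br; rewrite fps_sumE big1 // => j _; rewrite fpsZE fpsXE.
case: eqP => [bj|]; rewrite ?mulr0 //.
by have /mon_irreducible : exists i, mon i = b; [exists j|rewrite br].
Qed.

Lemma irred_part_mspan z : mspan K m mon (irred_part L z).
Proof.
exists (fun i => z (mon i)); apply: fpsP => b; rewrite irred_partE.
case: (boolP (reducible L b)) => [br|]; first by rewrite mon_sum_reducible.
by move=> /mon_irreducible[i <-]; rewrite mon_sum_coef.
Qed.

Lemma irred_part_id p : mspan K m mon p -> irred_part L p = p.
Proof.
move=> [c ->]; apply: fpsP => b; rewrite irred_partE; case: ifP => // br.
by rewrite mon_sum_reducible.
Qed.

(** Without reducible terms all quotients are zero. This makes [NF1] the identity on <m>K[[s]],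
    hence surjective onto it and idempotent. *)
Lemma recompose_mspan p : mspan K m mon p -> recompose D g U L p = p.
Proof.
move=> pm; have q0 j : quotient g L p j = 0.
  apply: fpsP => b; rewrite quotientE; case: ifP => // /andP[Lb _].
  case: pm => c ->; rewrite mon_sum_reducible ?scaler0 //.
  by apply/existsP; exists j.
rewrite /recompose irred_part_id // big1 => [|j _]; last by rewrite q0 mulr0.
rewrite sDact_eq0 ?subr0 ?addr0 // => i.
by rewrite mxE big1 // => j _; rewrite q0 mulr0.
Qed.

Lemma piH_mon_sum (c : 'I_mu -> {fps K[m]}) :
  \sum_i c i *: piH F (fpsX (mon i)) = piH F (\sum_i c i *: fpsX (mon i)).
Proof.
rewrite (big_morph _ (piHD F) (raddf0 (\pi_{ideal_quot imF F}%qT))).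
by apply: eq_bigr => i _; rewrite piHZ.
Qed.

(** The part of a relation at s = 0 lies in <f> and involves irreducible monomials only. This is the
    hypothesis on constant terms in [free_ker_trivial]. *)
Lemma mon_relation_max (c : 'I_mu -> {fps K[m]}) : standard_basis ltx f g ->
  \sum_i c i *: piH F (fpsX (mon i)) = 0 -> forall i, c i 0%MM = 0.
Proof.
move=> g_std; rewrite piH_mon_sum => c0 i; set p := (X in piH F X) in c0.
have pF : p \in imF F.
  have /eqP : piH F p = piH F 0 by rewrite c0 /piH raddf0.
  by rewrite -Quotient.idealrBE subr0.
have h0 : scoef p 0%MM = 0.
  apply: irreducible_ideal_eq0 (imF_scoef0 pF) _ => // b; apply: contraNN => br.
  by rewrite scoefE /p mon_sum_reducible.
have := congr1 (fun h : {fps K[n]} => h (mon i)) h0.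
by rewrite scoefE /p mon_sum_coef.
Qed.

End Presentation.
Lemma finsupp_sum (A : nzRingType) (I : finType) (M : lmodType A)
  (c : {fsfun I -> A with 0}) (e : I -> M) :
  \sum_(i <- finsupp c) c i *: e i = \sum_i c i *: e i.
Proof.
rewrite big_uniq ?fset_uniq //= [RHS](bigID (mem (finsupp c))) /=.
by rewrite [X in _ + X]big1 ?addr0 // => i ic; rewrite fsfun_dflt // scale0r.
Qed.

Theorem proposition22 (K : fieldType) (m n r l mu : nat)
  (degs : 'X_{1..m} -> rat) (lts : rel 'X_{1..m})
  (degx : 'X_{1..n} -> rat) (ltx : rel 'X_{1..n})
  (f : 'rV[{fps K[n]}]_r) (D : 'M[diffop K m n]_(m, r))
  (F : 'rV[diffop K m n]_r)
  (g : 'rV[{fps K[n]}]_l) (U : 'M[{fps K[n]}]_(r, l))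
  (mon : 'I_mu -> 'X_{1..n}) (k : nat -> int)
  (n_gt0 : (0 < n)%N)
  (lts_ord : local_degree_ordering degs lts)
  (ltx_ord : local_degree_ordering degx ltx)
  (F_def : F = Fop f D)
  (f_finite : exists e : nat,
     ideal_exp (ideal_span (range (fun i : 'I_n => fpsX U_(i)%MM))) e
       `<=` ideal_span (range (f 0)))
  (g_std : standard_basis ltx f g)
  (g_U : g = f *m U)
  (mon_std : standard_monomials ltx g mon)
  (D_neq0 : D != 0)
  (mu_gt0 : (0 < mu)%N)
  (degs_cond : degree_condition degs degx D mon)
  (NK_incr : forall a b : int, a <= 0 -> b <= 0 -> a < b ->
     NK degs degx D a < NK degs degx D b)
  (k_le0 : forall i, k i <= 0)
  (k_decr : forall i, k i.+1 < k i) :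
  exists (NF1 : Ksx K m n -> Ksx K m n) (NF2 : Ksx K m n -> 'rV[Ksx K m n]_l),
    (forall p t a, is_NF degs degx lts ltx D g U k p t a <->
       t = NF1 p /\ a = NF2 p) /\
    [/\ linear NF1 /\ range NF1 = mspan K m mon,
        forall p, piH F (NF1 p) = piH F p,
        piH F @` mspan K m mon = setT,
        forall p, NF1 (NF1 p) = NF1 p
      & free_lmodule (Hmod F) ->
        exists sigma : Hmod F -> Ksx K m n,
          [/\ linear sigma,
              forall h, piH F (sigma h) = h,
              forall p, sigma (piH F p) = NF1 p,
              range sigma = mspan K m mon
            & lmod_basis (fun i => piH F (fpsX (mon i))) /\
              forall c : 'I_mu -> {fps K[m]},
                sigma (\sum_i c i *: piH F (fpsX (mon i)))
                  = \sum_i c i *: fpsX (mon i)]].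
Proof.
have [L gL] : {L : 'I_l -> 'X_{1..n} & forall j, is_xlead ltx (g 0 j) (L j)}.
  apply: (@boolp.choice _ _ (fun j b => is_xlead ltx (g 0 j) b)) => j.
  by apply: (xlead_exists ltx_ord); case: (g_std.1 j).
pose Phi := recompose D g U L.
have [Z PhiZ] : {Z : Ksx K m n -> Ksx K m n & forall p, Phi (Z p) = p}.
  apply: (@boolp.choice _ _ (fun p z => Phi z = p)) => p.
  exact: (recompose_surj lts_ord ltx_ord D U gL).
have PhiI : injective Phi := recompose_inj lts_ord ltx_ord gL.
have Z_linear u p q : Z (u *: p + q) = u *: Z p + Z q.
  by apply: PhiI; rewrite PhiZ [RHS]recompose_linear -/Phi !PhiZ.
pose NF1 p := irred_part L (Z p).
have NF1_linear u p q : NF1 (u *: p + q) = u *: NF1 p + NF1 q.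
  by rewrite /NF1 Z_linear irred_part_linear.
have NF1_mspan p : mspan K m mon (NF1 p).
  exact: (irred_part_mspan ltx_ord gL mon_std).
have NF1_id p : mspan K m mon p -> NF1 p = p.
  move=> pm; have Zp : Z p = p.
    by apply: PhiI; rewrite PhiZ [RHS](recompose_mspan ltx_ord D U gL mon_std pm).
  by rewrite /NF1 Zp (irred_part_id ltx_ord gL mon_std pm).
have piNF1 p : piH F (NF1 p) = piH F p.
  apply/esym/piH_eq; rewrite F_def -[p in p - _]PhiZ.
  exact: recompose_imF.
have pi_mspan (h : Hmod F) : exists2 p, mspan K m mon p & piH F p = h.
  exists (NF1 (repr (h : {ideal_quot imF F}%qT))); first exact: NF1_mspan.
  by rewrite piNF1 piH_repr.
exists NF1, (fun p => \row_j quotient g L (Z p) j); split=> [p t a|].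
  rewrite -{1}[p]PhiZ.
  exact: (is_NF_recompose lts_ord ltx_ord U gL NK_incr k_le0 k_decr).
split=> //.
- split; first by move=> u p q; apply: NF1_linear.
  apply/seteqP; split=> [_ [p _ <-] //|p pm].
  by exists p => //; apply: NF1_id.
- apply/seteqP; split=> // h _; have [p pm ph] := pi_mspan h.
  by exists p.
- by move=> p; apply: NF1_id.
move=> H_free; pose e i := piH F (fpsX (mon i) : Ksx K m n).
have piE (c : 'I_mu -> {fps K[m]}) :
    \sum_i c i *: e i = piH F (\sum_i c i *: fpsX (mon i)).
  by rewrite /e F_def piH_mon_sum.
(* Freeness of H enters here; injectivity of pi_H on <m>K[[s]] follows. *)
have e_free : forall c : 'I_mu -> {fps K[m]}, \sum_i c i *: e i = 0 ->
    forall i, c i = 0.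
  apply: free_ker_trivial => //.
    move=> h; have [_ [c ->] <-] := pi_mspan h.
    by exists c; rewrite piE.
  move=> c; rewrite /e F_def => c0.
  exact: (mon_relation_max ltx_ord gL mon_std g_std c0).
have pi_inj p q : mspan K m mon p -> mspan K m mon q ->
    piH F p = piH F q -> p = q.
  move=> [c ->] [d ->]; rewrite -!piE => /eqP.
  rewrite -subr_eq0 -sumrB => /eqP cd.
  apply: eq_bigr => i _; congr (_ *: _); apply/eqP; rewrite -subr_eq0; apply/eqP.
  apply: (e_free (fun i => c i - d i)); rewrite -[RHS]cd.
  by apply: eq_bigr => j _; rewrite scalerBl.
(* [repr] picks an arbitrary preimage; [pi_inj] makes the value independent of it. *)
pose sigma (h : Hmod F) := NF1 (repr (h : {ideal_quot imF F}%qT)).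
have sigma_pi p : sigma (piH F p) = NF1 p.
  apply: pi_inj; [exact: NF1_mspan|exact: NF1_mspan|].
  by rewrite !piNF1 piH_repr.
have pi_sigma h : piH F (sigma h) = h by rewrite piNF1 piH_repr.
exists sigma; split=> //.
- move=> u h h' /=; rewrite -[in LHS](piH_repr h) -[in LHS](piH_repr h').
  rewrite -[X in sigma (X + _)]piHZ.
  by rewrite -piHD sigma_pi NF1_linear.
- apply/seteqP; split=> [_ [h _ <-]|p pm]; first exact: NF1_mspan.
  by exists (piH F p) => //; rewrite sigma_pi NF1_id.
split=> [h|c]; last first.
  by rewrite -/(e _) piE sigma_pi NF1_id //; exists c.
have [_ [c ->] <-] := pi_mspan h; rewrite -piE.
pose c' := [fsfun i in [fset i in enum 'I_mu]%fset => c i : {fps K[m]} | 0].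
have c'E i : c' i = c i by rewrite fsfunE !inE mem_enum.
exists c'; split=> [|d].
  by rewrite finsupp_sum; apply: eq_bigr => i _; rewrite c'E.
rewrite finsupp_sum => /eqP; rewrite -subr_eq0 -sumrB => /eqP cd.
apply/fsfunP => i; rewrite c'E; apply/eqP; rewrite -subr_eq0; apply/eqP.
apply: (e_free (fun i => c i - d i)); rewrite -[RHS]cd.
by apply: eq_bigr => j _; rewrite scalerBl.
Qed.
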